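(* The virtual braid group on $n$ strands $\mathcal{VB}r_n$ is indecomposable.
   Context: The virtual braid group on $n$ strands $\mathcal{VB}r_n$ is the group with generators $\sigma_1,\ldots,\sigma_{n-1},\tau_1,\ldots,\tau_{n-1}$ and relations: (VB1) $\sigma_i\sigma_{i+1}\sigma_i=\sigma_{i+1}\sigma_i\sigma_{i+1}$ for $1\le i\le n-2$, and $\sigma_i\sigma_j=\sigma_j\sigma_i$ for $|i-j|\ge 2$, $1\le i,j\le n-1$; (VB2) $\tau_i\tau_{i+1}\tau_i=\tau_{i+1}\tau_i\tau_{i+1}$ for $1\le i\le n-2$, $\tau_i\tau_j=\tau_j\tau_i$ for $|i-j|\ge 2$, $1\le i,j\le n-1$, and $\tau_i^2=\mathrm{id}$ for $1\le i\le n-1$; (VB3) $\tau_i\tau_{i+1}\sigma_i=\sigma_{i+1}\tau_i\tau_{i+1}$ for $1\le i\le n-2$, and $\sigma_i\tau_j=\tau_j\sigma_i$ for $|i-j|\ge 2$, $1\le i,j\le n-1$. A group $G$ is decomposable if it is the (internal) direct product $G=H\times K$ of two proper subgroups $H,K$, and indecomposable otherwise. *)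

(* Defs.v *)
From HB Require Import structures.
From mathcomp Require Import all_boot.
From mathcomp Require Import boolp.

Set Implicit Arguments.
Unset Strict Implicit.
Unset Printing Implicit Defensive.

Local Open Scope group_scope.
Local Open Scope quotient_scope.

(* [(x, true)] stands for the generator [x], [(x, false)] for its inverse. *)
Definition letter (X : Type) : Type := (X * bool)%type.
Definition word (X : Type) : Type := seq (letter X).

Definition linv (X : Type) (l : letter X) : letter X := (l.1, ~~ l.2).
Definition winv (X : Type) (w : word X) : word X := rev (map (@linv X) w).

(* The least congruence containing [R] and free cancellation; its quotient is
   the group < X | u = v for R u v >. *)
Inductive pres_congr (X : Type) (R : word X -> word X -> Prop) :
    word X -> word X -> Prop :=
| pres_refl u : pres_congr R u u
| pres_sym u v : pres_congr R u v -> pres_congr R v u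
| pres_trans v u w : pres_congr R u v -> pres_congr R v w -> pres_congr R u w
| pres_cat u u' v v' :
    pres_congr R u u' -> pres_congr R v v' -> pres_congr R (u ++ v) (u' ++ v')
| pres_cancel l : pres_congr R [:: l; linv l] [::]
| pres_rel u v : R u v -> pres_congr R u v.

Section Presented.
Variables (X : choiceType) (R : word X -> word X -> Prop).

Definition pres_eqb : rel (word X) := fun u v => `[< pres_congr R u v >].

Lemma pres_eqb_refl : reflexive pres_eqb.
Proof. by move=> u; apply/asboolP; exact: pres_refl. Qed.

Lemma pres_eqb_sym : symmetric pres_eqb.
Proof. by move=> u v; apply/asboolP/asboolP => h; exact: pres_sym. Qed.

Lemma pres_eqb_trans : transitive pres_eqb.
Proof.
by move=> v u w /asboolP uv /asboolP vw; apply/asboolP; exact: pres_trans uv vw.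
Qed.

Canonical pres_equiv :=
  EquivRel pres_eqb pres_eqb_refl pres_eqb_sym pres_eqb_trans.

Definition presented : Type := {eq_quot pres_equiv}.

HB.instance Definition _ := Choice.on presented.
HB.instance Definition _ := EqQuotient.on presented.

Lemma presentedP (u v : word X) :
  \pi_presented u = \pi_presented v <-> pres_congr R u v.
Proof. by split => [/eqmodP/asboolP | h]; last exact/eqmodP/asboolP. Qed.

Definition pres_one : presented := \pi_presented [::].
Definition pres_mul (a b : presented) : presented :=
  \pi_presented (repr a ++ repr b).
Definition pres_inv (a : presented) : presented :=
  \pi_presented (winv (repr a)).

Lemma repr_pi (u : word X) : pres_congr R (repr (\pi_presented u)) u.
Proof. by apply/presentedP; rewrite reprK. Qed.

Lemma pres_mulE (u v : word X) :
  pres_mul (\pi_presented u) (\pi_presented v) = \pi_presented (u ++ v).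
Proof. by apply/presentedP; apply: pres_cat; exact: repr_pi. Qed.

Lemma linvK : involutive (@linv X).
Proof. by case=> x b; rewrite /linv /= negbK. Qed.

Lemma winvK : involutive (@winv X).
Proof. by move=> u; rewrite /winv map_rev revK mapK //; exact: linvK. Qed.

Lemma pres_mulwV (u : word X) : pres_congr R (u ++ winv u) [::].
Proof.
elim: u => [|l u IHu]; first exact: pres_refl.
have -> : (l :: u) ++ winv (l :: u) = [:: l] ++ (u ++ winv u) ++ [:: linv l].
  by rewrite /winv /= rev_cons -cats1 !catA.
apply: (@pres_trans _ _ ([:: l] ++ [::] ++ [:: linv l])); last exact: pres_cancel.
apply: pres_cat; first exact: pres_refl.
by apply: pres_cat => //; exact: pres_refl.
Qed.

Lemma pres_mulVw (u : word X) : pres_congr R (winv u ++ u) [::].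
Proof. by rewrite -{2}(winvK u); exact: pres_mulwV. Qed.

Lemma pres_winv (u v : word X) :
  pres_congr R u v -> pres_congr R (winv u) (winv v).
Proof.
move=> uv; apply: (@pres_trans _ _ (winv u ++ (v ++ winv v))).
  rewrite -{1}[winv u]cats0; apply: pres_cat; first exact: pres_refl.
  exact/pres_sym/pres_mulwV.
rewrite catA -[winv v in X in pres_congr R _ X]cat0s.
apply: pres_cat; last exact: pres_refl.
apply: (pres_trans (v := winv u ++ u)); last exact: pres_mulVw.
by apply: pres_cat; [exact: pres_refl | exact: pres_sym].
Qed.

Lemma pres_invE (u : word X) :
  pres_inv (\pi_presented u) = \pi_presented (winv u).
Proof. by apply/presentedP; apply: pres_winv; exact: repr_pi. Qed.

Lemma pres_mulA : associative pres_mul.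
Proof.
elim/quotW=> u; elim/quotW=> v; elim/quotW=> w.
by rewrite (pres_mulE v w) (pres_mulE u v) (pres_mulE u) pres_mulE catA.
Qed.

Lemma pres_mul1 : left_id pres_one pres_mul.
Proof. by move=> a; rewrite -[a]reprK /pres_one pres_mulE. Qed.

Lemma pres_mulr1 : right_id pres_one pres_mul.
Proof. by move=> a; rewrite -[a]reprK /pres_one pres_mulE cats0. Qed.

Lemma pres_mulV : left_inverse pres_one pres_inv pres_mul.
Proof.
move=> a; rewrite -[a]reprK pres_invE pres_mulE.
by apply/presentedP; exact: pres_mulVw.
Qed.

Lemma pres_mulrV : right_inverse pres_one pres_inv pres_mul.
Proof.
move=> a; rewrite -[a]reprK pres_invE pres_mulE.
by apply/presentedP; exact: pres_mulwV.
Qed.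

HB.instance Definition _ := isGroup.Build presented
  pres_mulA pres_mul1 pres_mulr1 pres_mulV pres_mulrV.

End Presented.

(* Indices start at 0: [i : 'I_n.-1] stands for the index i + 1 in
   {1, ..., n - 1}. *)
Inductive vb_gen (n : nat) : Type :=
| Sigma of 'I_n.-1
| Tau of 'I_n.-1.

Definition vb_gen_code n (g : vb_gen n) : 'I_n.-1 + 'I_n.-1 :=
  match g with Sigma i => inl i | Tau i => inr i end.
Definition vb_gen_decode n (c : 'I_n.-1 + 'I_n.-1) : vb_gen n :=
  match c with inl i => Sigma i | inr i => Tau i end.

Lemma vb_gen_codeK n : cancel (@vb_gen_code n) (@vb_gen_decode n).
Proof. by case. Qed.

HB.instance Definition _ n := Countable.copy (vb_gen n)
  (can_type (@vb_gen_codeK n)).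

Definition sigma n (i : 'I_n.-1) : word (vb_gen n) := [:: (Sigma i, true)].
Definition tau n (i : 'I_n.-1) : word (vb_gen n) := [:: (Tau i, true)].

Definition far (i j : nat) : bool := (i + 2 <= j) || (j + 2 <= i).

Inductive vb_rel (n : nat) : word (vb_gen n) -> word (vb_gen n) -> Prop :=
| VB1_braid (i j : 'I_n.-1) : j = i.+1 :> nat ->
    vb_rel (sigma i ++ sigma j ++ sigma i) (sigma j ++ sigma i ++ sigma j)
| VB1_comm (i j : 'I_n.-1) : far i j ->
    vb_rel (sigma i ++ sigma j) (sigma j ++ sigma i)
| VB2_braid (i j : 'I_n.-1) : j = i.+1 :> nat ->
    vb_rel (tau i ++ tau j ++ tau i) (tau j ++ tau i ++ tau j)
| VB2_comm (i j : 'I_n.-1) : far i j ->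
    vb_rel (tau i ++ tau j) (tau j ++ tau i)
| VB2_invol (i : 'I_n.-1) : vb_rel (tau i ++ tau i) [::]
| VB3_braid (i j : 'I_n.-1) : j = i.+1 :> nat ->
    vb_rel (tau i ++ tau j ++ sigma i) (sigma j ++ tau i ++ tau j)
| VB3_comm (i j : 'I_n.-1) : far i j ->
    vb_rel (sigma i ++ tau j) (tau j ++ sigma i).

Definition virtual_braid_group (n : nat) : groupType := presented (@vb_rel n).

(* Under the classical axioms in use every subset of [G] is a boolean
   predicate, so [{pred G}] covers all subgroups. *)
Definition internal_direct_product (G : groupType) (H K : {pred G}) : Prop :=
  [/\ group_closed H, group_closed K,
      forall h k, h \in H -> k \in K -> h * k = k * h,
      forall x, x \in H -> x \in K -> x = 1
    & forall g, exists h k, [/\ h \in H, k \in K & g = h * k]].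

Definition proper_subset (G : groupType) (H : {pred G}) : Prop :=
  exists x, x \notin H.

Definition decomposable (G : groupType) : Prop :=
  exists H K : {pred G},
    [/\ internal_direct_product H K, proper_subset H & proper_subset K].

Definition indecomposable (G : groupType) : Prop := ~ decomposable G.

(* Main.v *)
Require Import Defs.
From HB Require Import structures.
From mathcomp Require Import all_boot perm ssralg ssrnum ssrint.
From mathcomp Require Import boolp zify ring.

(* Let [A] be the kernel of the homomorphism [G -> 'S_n] with [sigma_i |-> 1] and
   [tau_i |-> (i i+1)].  It is the Artin group on the ordered pairs [(i, j)], where
   [(i, j)] and [(j, k)] satisfy the braid relation, disjoint pairs commute and
   all other pairs are free of relations.  The parabolic subgroups of an Artin
   group satisfy [A_X :&: A_Y = A_(X :&: Y)], by the set-theoretic retraction of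
   [A] on [A_X] that follows the Coxeter group of [A] on the cosets modulo [W_X].
   As [s = (i, j)] and [t = (j, i)] are free, [A] is the amalgam of the parabolic
   subgroups omitting [s] and [t] over the one omitting both.  If [G = H * K],
   the commuting normal subgroups [H :&: A] and [K :&: A] cannot both leave the
   edge group, for [n^-1 x n] is longer than [x] when [n] and the ends of [x] lie
   in different factors.  So one of them, say [H :&: A], omits every generator
   and is trivial.  Then [H] centralises [A], and an element [a w] of [H] gives
   [a d_(w s) a^-1 = d_s] for all [s], which the signed permutations of type [D]
   exclude unless [w = 1].  Hence [H = 1]. *)

Set Implicit Arguments.
Unset Strict Implicit.
Unset Printing Implicit Defensive.

Local Open Scope group_scope.
Local Open Scope quotient_scope.

Section Action.
Variables (X : choiceType) (R : word X -> word X -> Prop).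

Definition pres_gen (x : X) : presented R := \pi_(presented R) [:: (x, true)].

Lemma pres_genV x : (pres_gen x)^-1 = \pi_(presented R) [:: (x, false)].
Proof. by rewrite /pres_gen -[LHS]/(pres_inv _) pres_invE. Qed.

Lemma pi_cat u v :
  \pi_(presented R) (u ++ v) = \pi_(presented R) u * \pi_(presented R) v.
Proof. by rewrite -[RHS]/(pres_mul _ _) pres_mulE. Qed.

Lemma pres_ind (P : presented R -> Prop) :
    P 1 -> (forall x g, P g -> P (pres_gen x * g)) ->
    (forall x g, P g -> P ((pres_gen x)^-1 * g)) -> forall g, P g.
Proof.
move=> P1 PM PV; elim/quotW; elim=> [|[x b] u IH]; first exact: P1.
rewrite -cat1s pi_cat; case: b; first exact: PM.
by rewrite -pres_genV; exact: PV.
Qed.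

Variables (Z : Type) (f f' : X -> Z -> Z).
Hypotheses (fK : forall x, cancel (f x) (f' x))
  (f'K : forall x, cancel (f' x) (f x)).

Definition wact (u : word X) (z : Z) : Z :=
  foldr (fun l y => if l.2 then f l.1 y else f' l.1 y) z u.

Hypothesis fR : forall u v, R u v -> forall z, wact u z = wact v z.

Lemma wact_cat u v z : wact (u ++ v) z = wact u (wact v z).
Proof. exact: foldr_cat. Qed.

Lemma wact_congr u v : pres_congr R u v -> forall z, wact u z = wact v z.
Proof.
elim=> {u v} [||u v w _ IHu _ IHv|u u' v v' _ IHu _ IHv|[x []]|] //= *.
- by rewrite IHu IHv.
- by rewrite !wact_cat IHu IHv.
- by rewrite f'K.
- by rewrite fK.
Qed.

Lemma pres_action : exists op : presented R -> Z -> Z,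
  [/\ forall z, op 1 z = z, forall g h z, op (g * h) z = op g (op h z)
    & forall x z, op (pres_gen x) z = f x z].
Proof.
have opE u z : wact (repr (\pi_(presented R) u)) z = wact u z.
  by apply: wact_congr; exact: repr_pi.
exists (fun g => wact (repr g)); split=> [z|g h z|x z]; last exact: opE.
  exact: (opE [::]).
by rewrite -[g in LHS]reprK -[h in LHS]reprK -pi_cat opE wact_cat.
Qed.

End Action.

Arguments pres_gen {X R}.

Section WordReduction.

Inductive link := Comm | Braid | Free.

(* [E] is an equality of words, [pos w s] the assertion that [w] does not
   shorten when followed by [s]. *)
Variables (S : eqType) (m : S -> S -> link) (E : seq S -> seq S -> Prop)
  (pos : seq S -> S -> Prop).

(* The lengths of the alternating words on [s, t] ending in [t] that do not
   shorten when followed by [s]. *)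
Definition alt_bound (l : link) (k : nat) : bool :=
  match l with Comm => k <= 1 | Braid => k <= 2 | Free => true end.

Fixpoint altw (s t : S) (k : nat) : seq S :=
  if k is k'.+1 then rcons (altw t s k') t else [::].

Lemma size_altw s t k : size (altw s t k) = k.
Proof. by elim: k s t => //= k IH s t; rewrite size_rcons IH. Qed.

Hypothesis mC : forall s t, m s t = m t s.
Hypothesis E_refl : forall u, E u u.
Hypothesis E_sym : forall u v, E u v -> E v u.
Hypothesis E_trans : forall u v w, E u v -> E v w -> E u w.
Hypothesis E_cat : forall u v w, E u v -> E (u ++ w) (v ++ w).
Hypothesis E_invol : forall u s, E (u ++ [:: s; s]) u.
Hypothesis E_comm : forall u s t, s != t -> m s t = Comm ->
  E (u ++ [:: s; t]) (u ++ [:: t; s]).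
Hypothesis E_braid : forall u s t, s != t -> m s t = Braid ->
  E (u ++ [:: s; t; s]) (u ++ [:: t; s; t]).
Hypothesis pos_E : forall u v s, E u v -> pos u s -> pos v s.
Hypothesis pos_nil : forall s, pos [::] s.
Hypothesis pos_alt : forall v s t k, s != t -> pos v s -> pos v t ->
  alt_bound (m s t) k ->
  pos (v ++ altw s t k) s.

Definition shrinks v s := exists2 v', size v' < size v & E v' (v ++ [:: s]).

Lemma rank2 v s t d : s != t -> all (pred2 s t) d ->
  (exists2 d', size d' < size d & E (v ++ d') (v ++ d ++ [:: s])) \/
  exists2 k, d = altw s t k &
    alt_bound (m s t) k.
Proof.
elim/last_ind: d s t => [|d x IH] s t st; first by
  right; exists 0%N => //; case: (m s t).
rewrite all_rcons => /andP[xst dst].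
have [->|xs] := eqVneq x s.
  left; exists d; first by rewrite size_rcons.
  by apply: E_sym; rewrite cat_rcons catA.
have {xs xst} -> : x = t by move: xst; rewrite /= (negbTE xs) => /eqP.
have dts : all (pred2 t s) d by apply: sub_all dst => y /=; rewrite orbC.
case: (IH t s _ dts) => [|[d' sd' Ed']|[k Ek mk]]; first by rewrite eq_sym.
  left; exists (d' ++ [:: s]); first by rewrite size_cat size_rcons addn1 ltnS.
  by rewrite -cats1 -catA /= !catA in Ed' *; move: (E_cat [:: s] Ed'); rewrite -!catA.
rewrite Ek -/(altw s t k.+1) size_altw mC in mk *.
case mst : (m s t) mk => mk; last by right; exists k.+1.
- case: k mk {Ek} => [|[|//]] _; first by right; exists 1%N.
  left; exists [:: t] => //=.
  apply: E_trans (E_sym (E_invol _ s)) _; rewrite -catA /=.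
  have /(E_cat [:: s]) := E_comm v st mst.
  by rewrite -!catA /= => h; exact: E_sym.
- case: k mk {Ek} => [|[|[|//]]] _; [by right; exists 1%N|by right; exists 2|].
  left; exists [:: s; t] => //=.
  have /(E_cat [:: s]) := E_braid v st mst.
  rewrite -!catA /= => h; apply: E_sym; apply: E_trans (E_sym h) _.
  by move: (E_invol (v ++ [:: s; t]) s); rewrite -!catA.
Qed.

Lemma pos_or_shrinks w s : pos w s \/ shrinks w s.
Proof.
have [n] := ubnP (size w); elim: n w s => // n IH w s; rewrite ltnS => wn.
case/lastP: w wn => [|u t] wn; first by left.
rewrite size_rcons in wn.
have [->|ts] := eqVneq s t.
  right; exists u; first by rewrite size_rcons.
  by apply: E_sym; rewrite cat_rcons.
have peel k v d : size v < k -> all (pred2 s t) d -> E (v ++ d) (rcons u t) ->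
    size v <= size u -> size v + size d <= (size u).+1 ->
  exists v d, [/\ all (pred2 s t) d, E (v ++ d) (rcons u t),
    size v + size d <= (size u).+1, pos v s & pos v t].
  elim: k v d => // k IHk v d vk dst Evd vu vd.
  have vn : size v < n by apply: leq_ltn_trans wn.
  have next x : (x == s) || (x == t) -> shrinks v x ->
      exists v d, [/\ all (pred2 s t) d, E (v ++ d) (rcons u t),
        size v + size d <= (size u).+1, pos v s & pos v t].
    move=> xst [v' v'v Ev']; apply: (IHk v' (x :: d)).
    - exact: leq_trans v'v vk.
    - by rewrite /= xst.
    - apply: E_trans Evd.
      move: (E_cat (x :: d) Ev'); rewrite -catA /= => h; apply: E_trans h _.
      by move: (E_cat d (E_invol v x)); rewrite -!catA.
    - exact: leq_trans (ltnW v'v) vu.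
    - by rewrite /= addnS -addSn; apply: leq_trans vd; rewrite leq_add2r.
  case: (IH v s vn) => [ps|]; last by apply: next; rewrite eqxx.
  case: (IH v t vn) => [pt|]; last by apply: next; rewrite eqxx orbT.
  by exists v, d.
case: (peel (size u).+1 u [:: t]) => //=; rewrite ?eqxx ?orbT ?cats1 ?addn1 //.
move=> v [d [dst Evd vd ps pt]].
have st : s != t by [].
case: (@rank2 v s t d st dst) => [[d' d'd Ed']|[k dk mk]].
  right; exists (v ++ d').
    by rewrite size_cat size_rcons; apply: leq_trans vd; rewrite ltn_add2l.
  by apply: E_trans Ed' _; rewrite catA; exact: E_cat.
by left; apply: pos_E Evd _; rewrite dk; exact: pos_alt.
Qed.

End WordReduction.

(** * Roots of a simply laced Coxeter graph *)

Section Roots.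
Variables (S : finType) (m : S -> S -> link).
Hypothesis mC : forall s t, m s t = m t s.

Import GRing.Theory.
Local Open Scope ring_scope.

Local Notation V := {ffun S -> int}.

Definition cartan (s t : S) : int :=
  if s == t then 2 else match m s t with Comm => 0 | Braid => -1 | Free => - 2 end.

Definition simple_root (s : S) : V := [ffun u => (u == s)%:R].
Local Notation e := simple_root.

Definition coroot (t : S) (v : V) : int := \sum_u cartan t u * v u.

Definition form (v w : V) : int := \sum_t v t * coroot t w.

Definition reflection (t : S) (v : V) : V :=
  [ffun u => v u - coroot t v * (u == t)%:R].

Definition act (w : seq S) (v : V) : V := foldr reflection v w.

Definition nonneg (v : V) : Prop := forall u, 0 <= v u.

Lemma cartanC s t : cartan s t = cartan t s.
Proof. by rewrite /cartan eq_sym mC. Qed.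

Lemma corootD t v w : coroot t (v + w) = coroot t v + coroot t w.
Proof. by rewrite -big_split /=; apply: eq_bigr => u _; rewrite ffunE mulrDr. Qed.

Lemma coroot_root s t : coroot s (e t) = cartan s t.
Proof.
rewrite /coroot (bigD1 t) //= ffunE eqxx mulr1 big1 ?addr0 // => u ut.
by rewrite ffunE (negbTE ut) mulr0.
Qed.

Lemma coroot_reflection s t v :
  coroot s (reflection t v) = coroot s v - coroot t v * cartan s t.
Proof.
rewrite -coroot_root /coroot mulr_sumr -sumrB; apply: eq_bigr => u _.
by rewrite !ffunE; ring.
Qed.

Lemma form_root t w : form (e t) w = coroot t w.
Proof.
rewrite /form (bigD1 t) //= ffunE eqxx mul1r big1 ?addr0 // => u ut.
by rewrite ffunE (negbTE ut) mul0r.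
Qed.

Lemma formC v w : form v w = form w v.
Proof.
rewrite /form /coroot; under eq_bigr do rewrite mulr_sumr.
under [RHS]eq_bigr do rewrite mulr_sumr.
rewrite exchange_big /=; apply: eq_bigr => u _; apply: eq_bigr => t _.
by rewrite cartanC; ring.
Qed.

Lemma form_reflectionr t v w :
  form v (reflection t w) = form v w - coroot t w * coroot t v.
Proof.
rewrite -(form_root t v) [LHS]formC [form v w]formC.
rewrite /form mulr_sumr -sumrB; apply: eq_bigr => u _.
by rewrite !ffunE; ring.
Qed.

Lemma form_reflection t v w : form (reflection t v) (reflection t w) = form v w.
Proof.
rewrite form_reflectionr formC form_reflectionr formC !coroot_reflection.
by rewrite /cartan eqxx; ring.
Qed.

Lemma form_act w u v : form (act w u) (act w v) = form u v.
Proof. by elim: w => //= t w IH; rewrite form_reflection. Qed.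

Lemma reflectionD t v w : reflection t (v + w) = reflection t v + reflection t w.
Proof. by apply/ffunP => u; rewrite !ffunE corootD; ring. Qed.

Lemma reflection0 t : reflection t 0 = 0.
Proof. by apply: (addIr (reflection t 0)); rewrite -reflectionD !add0r. Qed.

Lemma reflectionN t v : reflection t (- v) = - reflection t v.
Proof. by apply: (addIr (reflection t v)); rewrite -reflectionD !addNr reflection0. Qed.

Lemma reflectionK t : involutive (reflection t).
Proof.
move=> v; apply/ffunP => u; rewrite !ffunE coroot_reflection /cartan eqxx; ring.
Qed.

Lemma actD w u v : act w (u + v) = act w u + act w v.
Proof. by elim: w => //= t w ->; rewrite reflectionD. Qed.

Lemma actN w v : act w (- v) = - act w v.
Proof. by elim: w => //= t w ->; rewrite reflectionN. Qed.

Lemma act_cat u v x : act (u ++ v) x = act u (act v x).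
Proof. exact: foldr_cat. Qed.

Lemma act_inj w : injective (act w).
Proof.
elim: w => [|t w IH] x y //= /(congr1 (reflection t)).
by rewrite !reflectionK; exact: IH.
Qed.

Lemma reflection_comm s t : s != t -> m s t = Comm ->
  forall v, reflection s (reflection t v) = reflection t (reflection s v).
Proof.
move=> st mst v; apply/ffunP => u; rewrite !ffunE !coroot_reflection.
by rewrite [cartan t s]cartanC /cartan (negbTE st) mst; ring.
Qed.

Lemma reflection_braid s t : s != t -> m s t = Braid -> forall v,
  reflection s (reflection t (reflection s v)) =
  reflection t (reflection s (reflection t v)).
Proof.
move=> st mst v; apply/ffunP => u; rewrite !ffunE !coroot_reflection.
by rewrite [cartan t s]cartanC /cartan !eqxx (negbTE st) mst; ring.
Qed.

Lemma reflection_self t : reflection t (e t) = - e t.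
Proof.
by apply/ffunP => u; rewrite !ffunE coroot_root /cartan eqxx; ring.
Qed.

Lemma reflection_root_comm s t : s != t -> m s t = Comm -> reflection t (e s) = e s.
Proof.
move=> st mst; apply/ffunP => u.
by rewrite !ffunE coroot_root cartanC /cartan (negbTE st) mst; ring.
Qed.

Lemma reflection_root_braid s t : s != t -> m s t = Braid ->
  reflection t (e s) = e s + e t.
Proof.
move=> st mst; apply/ffunP => u.
by rewrite !ffunE coroot_root cartanC /cartan (negbTE st) mst; ring.
Qed.

Lemma reflection_root_braidC s t : s != t -> m s t = Braid ->
  reflection s (e t) = e s + e t.
Proof.
by move=> st mst; rewrite reflection_root_braid 1?eq_sym 1?mC // addrC.
Qed.

Lemma reflection_root_free s t : s != t -> m s t = Free ->
  reflection t (e s) = e s + e t + e t.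
Proof.
move=> st mst; apply/ffunP => u.
by rewrite !ffunE coroot_root cartanC /cartan (negbTE st) mst; ring.
Qed.

Lemma altw_root s t k : s != t -> alt_bound (m s t) k ->
  exists a b, act (altw s t k) (e s) = e s *+ a + e t *+ b.
Proof.
move=> st; case mst: (m s t) => /= bk.
- exists 1%N, 0%N; rewrite addr0; case: k bk => [|[|//]] //= _.
  exact: reflection_root_comm.
- case: k bk => [|[|[|//]]] /= _.
  + by exists 1%N, 0%N; rewrite addr0.
  + by exists 1%N, 1%N; rewrite reflection_root_braid.
  + exists 0%N, 1%N; rewrite reflection_root_braid // reflectionD reflection_self.
    by rewrite reflection_root_braid 1?eq_sym 1?mC // addrC addrK add0r.
- elim: k s t st mst {bk} => [|k IH] s t st mst.
    by exists 1%N, 0%N; rewrite addr0.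
  have ts : t != s by rewrite eq_sym.
  have mts : m t s = Free by rewrite mC.
  have [a [b Eab]] := IH t s ts mts.
  exists b.+1, a.+1; rewrite /= -cats1 act_cat /= reflection_root_free // actD Eab.
  have -> : act (altw t s k) (e s + e t) = e s + e t.
    clear a b Eab; elim: {IH} k s t st mst ts mts => //= k IH s t st mst ts mts.
    rewrite -cats1 act_cat /= reflectionD reflection_self reflection_root_free //.
    by rewrite addrC addrK IH // addrC.
  by rewrite !mulrS [e t *+ a + _]addrC !addrA; congr (_ + _); rewrite addrAC.
Qed.

Lemma nonneg_comb u v a b : nonneg u -> nonneg v -> nonneg (u *+ a + v *+ b).
Proof.
move=> pu pv x; rewrite ffunE !ffunMnE.
by apply: Num.Theory.addr_ge0; apply: Num.Theory.mulrn_wge0.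
Qed.

Lemma root_pos_or_shrinks w s :
  nonneg (act w (e s)) \/ shrinks (fun u v => act u =1 act v) w s.
Proof.
apply: (@pos_or_shrinks _ m (fun u v => act u =1 act v)
  (fun w s => nonneg (act w (e s)))) => {w s} //.
- by move=> u v uv x; rewrite uv.
- by move=> u v w uv vw x; rewrite uv.
- by move=> u v w uv x; rewrite !act_cat uv.
- by move=> u s x; rewrite act_cat /= reflectionK.
- by move=> u s t st mst x; rewrite !act_cat /= reflection_comm.
- by move=> u s t st mst x; rewrite !act_cat /= reflection_braid.
- by move=> u v s uv; rewrite uv.
- by move=> s u; rewrite ffunE; case: eqP.
move=> v s t k st ps pt bk; rewrite act_cat.
have [a [b ->]] := altw_root st bk.
have actMn n x : act v (x *+ n) = act v x *+ n.
  elim: n => [|n IH]; last by rewrite !mulrS actD IH.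
  by rewrite !mulr0n; apply: (addIr (act v 0)); rewrite -actD !add0r.
by rewrite actD !actMn; exact: nonneg_comb.
Qed.

Lemma root_sign w s : nonneg (act w (e s)) \/ nonneg (- act w (e s)).
Proof.
have [n] := ubnP (size w); elim: n w => // n IH w; rewrite ltnS => wn.
case: (root_pos_or_shrinks w s) => [|[w' w'w Ew']]; first by left.
have Es : act w' (e s) = - act w (e s).
  by rewrite Ew' act_cat /= reflection_self actN.
case: (root_pos_or_shrinks w' s) => [|[w'' w''w' Ew'']]; first by rewrite Es; right.
have <- : act w'' (e s) = act w (e s).
  by rewrite Ew'' act_cat /= reflection_self actN Es opprK.
by apply: IH; apply: leq_trans (leq_trans w''w' _) wn; exact: ltnW.
Qed.

Lemma simple_root_inj : injective e.
Proof.
by move=> s t /ffunP/(_ s); rewrite !ffunE eqxx; case: eqP => //.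
Qed.

Lemma form_simple s t : form (e s) (e t) = cartan s t.
Proof. by rewrite form_root coroot_root. Qed.

Lemma reflection_nonneg w x t : nonneg (act w (e x)) -> act w (e x) <> e t ->
  nonneg (reflection t (act w (e x))).
Proof.
set b := act w (e x) => pb bt.
case: (root_sign (t :: w) x) => //= nb; case: bt.
have b0 u : u != t -> b u = 0.
  move=> ut; have := nb u; have := pb u; rewrite !ffunE (negbTE ut).
  by rewrite mulr0 subr0 -/b; lia.
have bE : b = [ffun u => b t * (u == t)%:R].
  apply/ffunP => u; rewrite ffunE; have [->|ut] := eqVneq u t; first by rewrite mulr1.
  by rewrite b0 // mulr0.
have cE v : form b v = b t * coroot t v.
  rewrite /form (bigD1 t) //= big1 ?addr0 // => u ut; by rewrite b0 // mul0r.
have : form b b = 2 by rewrite form_act form_simple /cartan eqxx.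
rewrite cE -form_root formC cE coroot_root /cartan eqxx => b2.
have b1 : b t = 1 by have := pb t; nia.
by rewrite bE b1; apply/ffunP => u; rewrite !ffunE mul1r.
Qed.

Lemma act_support (Y : pred S) w v x : all Y w -> ~~ Y x -> act w v x = v x.
Proof.
move=> + Yx; elim: w => //= t w IH /andP[Yt /IH {}IH].
rewrite ffunE IH; case: eqP => [xt|_]; last by rewrite mulr0 subr0.
by rewrite xt Yt in Yx.
Qed.

End Roots.

(** * Artin groups and their parabolic subgroups *)

Section Artin.
Variables (S : finType) (m : S -> S -> link).

Inductive artin_rel : word S -> word S -> Prop :=
| Artin_comm s t : s != t -> m s t = Comm ->
    artin_rel [:: (s, true); (t, true)] [:: (t, true); (s, true)]
| Artin_braid s t : s != t -> m s t = Braid ->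
    artin_rel [:: (s, true); (t, true); (s, true)]
              [:: (t, true); (s, true); (t, true)].

Definition artin : groupType := presented artin_rel.
Definition agen (s : S) : artin := @pres_gen _ artin_rel s.

Lemma artin_ind (P : artin -> Prop) :
    P 1 -> (forall x g, P g -> P (agen x * g)) ->
    (forall x g, P g -> P ((agen x)^-1 * g)) -> forall g, P g.
Proof. exact: pres_ind. Qed.

Lemma agen_comm s t : s != t -> m s t = Comm ->
  agen s * agen t = agen t * agen s.
Proof.
move=> st mst; rewrite -!pi_cat.
by apply/presentedP/pres_rel; exact: Artin_comm.
Qed.

Lemma agen_braid s t : s != t -> m s t = Braid ->
  agen s * agen t * agen s = agen t * agen s * agen t.
Proof.
move=> st mst; have E u v w : agen u * agen v * agen w =
    \pi_(presented artin_rel) ([:: (u, true); (v, true)] ++ [:: (w, true)]).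
  by rewrite pi_cat -cat1s pi_cat.
by rewrite !E; apply/presentedP/pres_rel; exact: Artin_braid.
Qed.

Lemma artin_action (Z : Type) (f f' : S -> Z -> Z) :
    (forall x, cancel (f x) (f' x)) -> (forall x, cancel (f' x) (f x)) ->
    (forall s t, s != t -> m s t = Comm -> forall z, f s (f t z) = f t (f s z)) ->
    (forall s t, s != t -> m s t = Braid ->
       forall z, f s (f t (f s z)) = f t (f s (f t z))) ->
  exists op : artin -> Z -> Z,
    [/\ forall z, op 1 z = z, forall g h z, op (g * h) z = op g (op h z)
      & forall s z, op (agen s) z = f s z].
Proof.
move=> fK f'K fC fB.
by apply: (pres_action fK f'K) => _ _ [] s t st mst z /=; [exact: fC|exact: fB].
Qed.

Inductive gen (X : pred S) : artin -> Prop :=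
| gen_one : gen X 1
| gen_mul s g : X s -> gen X g -> gen X (agen s * g)
| gen_mulV s g : X s -> gen X g -> gen X ((agen s)^-1 * g).

Lemma genM X g h : gen X g -> gen X h -> gen X (g * h).
Proof.
move=> + Xh; elim=> [|s {}g Xs _ IH|s {}g Xs _ IH]; first by rewrite mul1g.
  by rewrite -mulgA; exact: gen_mul.
by rewrite -mulgA; exact: gen_mulV.
Qed.

Lemma gen_agen (X : pred S) s : X s -> gen X (agen s).
Proof. by move=> Xs; rewrite -[agen s]mulg1; exact/gen_mul/gen_one. Qed.

Lemma gen_agenV (X : pred S) s : X s -> gen X (agen s)^-1.
Proof. by move=> Xs; rewrite -[_^-1]mulg1; exact/gen_mulV/gen_one. Qed.

Lemma genV X g : gen X g -> gen X g^-1.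
Proof.
elim=> [|s {}g Xs _ IH|s {}g Xs _ IH]; first by rewrite invg1; exact: gen_one.
  by rewrite invgM; apply: genM IH _; exact: gen_agenV.
by rewrite invgM invgK; apply: genM IH _; exact: gen_agen.
Qed.

Lemma gen_sub (X Y : pred S) g : (forall s, X s -> Y s) -> gen X g -> gen Y g.
Proof.
move=> XY; elim=> [|s h Xs _ IH|s h Xs _ IH]; first exact: gen_one.
  by apply: gen_mul IH; exact: XY.
by apply: gen_mulV IH; exact: XY.
Qed.

Lemma gen_predT g : gen predT g.
Proof.
by elim/artin_ind: g => [|s g|s g];
  [exact: gen_one|exact: gen_mul|exact: gen_mulV].
Qed.

Lemma gen_pred0 g : gen pred0 g -> g = 1.
Proof. by case. Qed.

Lemma gen_pred1 s k : gen (pred1 s) (agen s ^+ k).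
Proof.
elim: k => [|k IH]; first exact: gen_one.
by rewrite expgS; apply: gen_mul IH; exact: eqxx.
Qed.

Lemma agen_expg s k : agen s ^+ k = 1 -> k = 0%N.
Proof.
pose f (_ : S) (z : int) := (z + 1)%R; pose f' (_ : S) (z : int) := (z - 1)%R.
case: (@artin_action int f f') => [||||op [op1 opM opE]].
- by move=> x z; rewrite /f /f'; lia.
- by move=> x z; rewrite /f /f'; lia.
- by [].
- by [].
have E z : op (agen s ^+ k) z = (z + k%:Z)%R.
  elim: k z => [|k IH] z; first by rewrite op1; lia.
  by rewrite expgS opM IH opE /f; lia.
by move=> h; have := E 0%R; rewrite h op1; lia.
Qed.

Hypothesis mC : forall s t, m s t = m t s.

Local Notation V := {ffun S -> int}.
Local Notation e := (@simple_root S).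
Local Notation state := {ffun S -> V}.

Section Retraction.
Variable X : pred S.

(* The states [x |-> w (e x)] for [w] a minimal coset representative
   modulo the parabolic subgroup of [X]. *)
Definition good (b : state) : Prop :=
  (exists w, forall x, b x = act m w (e x)) /\ forall x, X x -> nonneg (b x).

Definition label (t : S) (b : state) : option S := [pick x | X x && (b x == e t)].

Definition move (t : S) (b : state) : state := [ffun x => reflection m t (b x)].

(* A letter [t] fixing the coset of [w], that is with [t w = w x] for some [x]
   in [X], contributes [x] to the retraction; any other letter moves the coset
   and contributes nothing. *)
Definition rstep_by (d : S -> artin) (t : S) (z : artin * state) :=
  if `[< good z.2 >] then
    if label t z.2 is Some x then (d x * z.1, z.2) else (z.1, move t z.2)
  else z.

Definition rstep := rstep_by agen.
Definition rstepV := rstep_by (fun s => (agen s)^-1).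

Lemma labelP t b x : good b -> X x -> b x = e t -> label t b = Some x.
Proof.
move=> [[w bw] _] Xx bx; rewrite /label; case: pickP => [y|/(_ x)]; last first.
  by rewrite Xx bx eqxx.
case/andP=> Xy /eqP; rewrite -bx !bw => /act_inj.
by move=> /(simple_root_inj (S := S)) ->.
Qed.

Lemma labelK t b x : label t b = Some x -> X x /\ b x = e t.
Proof. by rewrite /label; case: pickP => // y /andP[Xy /eqP bt] [<-]. Qed.

Lemma labelN t (b : state) : (forall x, X x -> b x <> e t) -> label t b = None.
Proof.
by move=> h; rewrite /label; case: pickP => // x /andP[Xx /eqP bx]; case: (h x Xx bx).
Qed.

Lemma labelNP t b x : label t b = None -> X x -> b x <> e t.
Proof.
move=> + Xx bx; rewrite /label; case: pickP => // /(_ x).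
by rewrite Xx bx eqxx.
Qed.

Lemma moveK t : involutive (move t).
Proof. by move=> b; apply/ffunP => x; rewrite !ffunE reflectionK. Qed.

Lemma good_move t b : good b -> label t b = None -> good (move t b).
Proof.
move=> [[w bw] pb] lt; split=> [|x Xx]; first by exists (t :: w) => x; rewrite ffunE bw.
rewrite ffunE bw; apply: reflection_nonneg => //; first by rewrite -bw; exact: pb.
by rewrite -bw; exact: labelNP lt Xx.
Qed.

Lemma nonneg_rootN t : ~ nonneg (- e t)%R.
Proof. by move=> /(_ t); rewrite !ffunE eqxx. Qed.

Lemma label_move t b : good b -> label t b = None -> label t (move t b) = None.
Proof.
move=> [_ pb] _; apply: labelN => x Xx; rewrite ffunE => h.
have bx : b x = (- e t)%R by rewrite -(reflectionK m t (b x)) h reflection_self.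
by have := pb x Xx; rewrite bx; exact: nonneg_rootN.
Qed.

Lemma good_form b x y : good b -> form m (b x) (b y) = cartan m x y.
Proof. by move=> [[w bw] _]; rewrite !bw form_act ?form_simple. Qed.

Lemma rstepL d t x h b : good b -> label t b = Some x ->
  rstep_by d t (h, b) = (d x * h, b).
Proof. by move=> gb lt; rewrite /rstep_by /= asboolT // lt. Qed.

Lemma rstepN d t h b : good b -> label t b = None ->
  rstep_by d t (h, b) = (h, move t b).
Proof. by move=> gb lt; rewrite /rstep_by /= asboolT // lt. Qed.

Lemma rstep_bad d t h b : ~ good b -> rstep_by d t (h, b) = (h, b).
Proof. by move=> gb; rewrite /rstep_by /= asboolF. Qed.

Lemma rstepK d d' t : (forall x, d x * d' x = 1) ->
  cancel (rstep_by d' t) (rstep_by d t).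
Proof.
move=> dK [h b]; have [gb|gb] := pselect (good b); last by rewrite !rstep_bad.
case lt: (label t b) => [x|].
  by rewrite (rstepL _ _ gb lt) (rstepL _ _ gb lt) mulgA dK mul1g.
by rewrite !rstepN ?moveK //; [exact: good_move|exact: label_move].
Qed.

Lemma link_label s t b x y : good b -> s != t ->
  label s b = Some x -> label t b = Some y -> x != y /\ m x y = m s t.
Proof.
move=> gb st /labelK[Xx bx] /labelK[Xy by_].
have := good_form x y gb; rewrite bx by_ form_simple // /cartan (negbTE st).
by case: eqP => _; case: (m s t) => //; case: (m x y).
Qed.

Lemma label_moved s t b x : good b -> label t b = None -> X x ->
  b x = reflection m t (e s) -> label s (move t b) = Some x.
Proof.
move=> gb lt Xx bx; apply: labelP => //; first exact: good_move.
by rewrite ffunE bx reflectionK.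
Qed.

Lemma label_moved_inv s t b x :
  label s (move t b) = Some x -> X x /\ b x = reflection m t (e s).
Proof. by case/labelK=> Xx; rewrite ffunE => <-; rewrite reflectionK. Qed.

Lemma rstep_comm s t : s != t -> m s t = Comm ->
  forall z, rstep s (rstep t z) = rstep t (rstep s z).
Proof.
move=> st mst [h b]; have [gb|gb] := pselect (good b); last first.
  by rewrite /rstep !rstep_bad.
have ts : t != s by rewrite eq_sym.
have mts : m t s = Comm by rewrite mC.
have half s' t' x : s' != t' -> m s' t' = Comm -> label s' b = Some x ->
    label t' b = None ->
    rstep s' (rstep t' (h, b)) = rstep t' (rstep s' (h, b)).
  move=> st' mst' ls lt; have [Xx bx] := labelK ls.
  rewrite /rstep (rstepN _ _ gb lt) (rstepL _ _ gb ls) (rstepN _ _ gb lt).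
  rewrite (@rstepL _ _ x) //; first exact: good_move.
  by apply: label_moved => //; rewrite reflection_root_comm.
case ls: (label s b) => [x|]; case lt: (label t b) => [y|].
- have [xy mxy] := link_label gb st ls lt.
  rewrite /rstep (rstepL _ _ gb ls) (rstepL _ _ gb lt).
  rewrite (rstepL _ _ gb ls) (rstepL _ _ gb lt) !mulgA.
  by rewrite agen_comm // mxy.
- exact: half st mst ls lt.
- by apply: esym; exact: half ts mts lt ls.
have none s' t' : s' != t' -> m s' t' = Comm -> label s' b = None ->
    label s' (move t' b) = None.
  move=> st' mst' ls0; apply: labelN => x Xx; rewrite ffunE => h'.
  apply: (labelNP ls0 Xx); rewrite -[LHS](reflectionK m t') h'.
  exact: reflection_root_comm.
rewrite /rstep (rstepN _ _ gb ls) (rstepN _ _ gb lt).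
rewrite !rstepN ?none //; try exact: good_move.
by congr pair; apply/ffunP => x; rewrite !ffunE reflection_comm.
Qed.

Lemma rstep_braid s t : s != t -> m s t = Braid ->
  forall z, rstep s (rstep t (rstep s z)) = rstep t (rstep s (rstep t z)).
Proof.
move=> st mst [h b]; have [gb|gb] := pselect (good b); last first.
  by rewrite /rstep !rstep_bad.
have ts : t != s by rewrite eq_sym.
have mts : m t s = Braid by rewrite mC.
have half s' t' x : s' != t' -> m s' t' = Braid -> label s' b = Some x ->
    label t' b = None ->
    rstep s' (rstep t' (rstep s' (h, b))) = rstep t' (rstep s' (rstep t' (h, b))).
  move=> st' mst' ls lt; have [Xx bx] := labelK ls.
  have gt := good_move gb lt.
  have lst : label s' (move t' b) = None.
    apply: labelN => y Xy; rewrite ffunE => h'.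
    have by_ : b y = (e s' + e t')%R.
      by rewrite -(reflectionK m t' (b y)) h' reflection_root_braid.
    have := good_form x y gb; rewrite bx by_ form_root corootD !coroot_root.
    by rewrite /cartan eqxx (negbTE st') mst'; case: eqP => // _; case: (m x y).
  rewrite /rstep (rstepL _ _ gb ls) (rstepN _ _ gb lt) (rstepN _ _ gb lt).
  rewrite (rstepN _ _ gt lst) (rstepN _ _ gt lst).
  rewrite (@rstepL _ _ x) //; first exact: good_move.
  apply: label_moved => //.
  by rewrite ffunE bx reflection_root_braid // reflection_root_braidC.
case ls: (label s b) => [x|]; case lt: (label t b) => [y|].
- have [xy mxy] := link_label gb st ls lt.
  rewrite /rstep; do 2![rewrite !(rstepL _ _ gb ls) !(rstepL _ _ gb lt)].
  by rewrite !mulgA agen_braid // mxy.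
- exact: half st mst ls lt.
- by apply: esym; exact: half ts mts lt ls.
have gs := good_move gb ls; have gt := good_move gb lt.
have swap s' t' x : s' != t' -> m s' t' = Braid -> label s' b = None ->
    label t' b = None ->
    label t' (move s' b) = Some x -> label s' (move t' b) = Some x.
  move=> st' mst' ls' lt' /label_moved_inv[Xx bx]; apply: label_moved => //.
  by rewrite bx reflection_root_braidC // reflection_root_braid.
rewrite /rstep (rstepN _ _ gb ls) (rstepN _ _ gb lt).
case lts: (label t (move s b)) => [x|].
  have lst := swap s t x st mst ls lt lts.
  rewrite (rstepL _ _ gs lts) (rstepL _ _ gt lst).
  by rewrite !rstepN ?moveK //; exact: label_move.
have lst : label s (move t b) = None.
  case lst: (label s (move t b)) => [x|//].
  by rewrite (swap t s x ts mts lt ls lst) in lts.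
rewrite (rstepN _ _ gs lts) (rstepN _ _ gt lst).
have none s' t' : s' != t' -> m s' t' = Braid -> label t' b = None ->
    label s' (move t' (move s' b)) = None.
  move=> st' mst' lt'; apply: labelN => x Xx; rewrite !ffunE => h'.
  apply: (labelNP lt' Xx).
  rewrite -[LHS](reflectionK m s') -[X in reflection m s' X = _](reflectionK m t').
  rewrite h' reflection_root_braid // reflectionD reflection_self.
  by rewrite reflection_root_braidC // GRing.addKr.
rewrite !rstepN ?none //; try exact: good_move.
by congr pair; apply/ffunP => x; rewrite !ffunE reflection_braid.
Qed.

(* From the trivial coset, a word in [X] contributes all its letters, and a word
   in [Y] contributes only letters in [Y], as [w (e x) = e t] with [w] and [t] in
   [Y] forces [x] in [Y]. *)
Lemma gen_inter Y g : gen X g -> gen Y g -> gen (predI X Y) g.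
Proof.
case: (@artin_action _ rstep rstepV).
- by move=> x; apply: rstepK => s; rewrite mulVg.
- by move=> x; apply: rstepK => s; rewrite mulgV.
- exact: rstep_comm.
- exact: rstep_braid.
move=> op [op1 opM opE].
have stepK s : cancel (rstepV s) (rstep s) by apply: rstepK => x; exact: mulgV.
have opV s z : op (agen s)^-1 z = rstepV s z.
  by rewrite -[X in op _ X](stepK s) -opE -opM mulVg op1.
pose b0 : state := [ffun x => e x].
have gb0 : good b0.
  split=> [|x _]; first by exists [::] => x; rewrite ffunE.
  by rewrite ffunE => u; rewrite ffunE; case: eqP.
have b0X s : X s -> label s b0 = Some s.
  by move=> Xs; apply: labelP; rewrite // ffunE.
have onX k : gen X k -> op k (1, b0) = (k, b0).
  elim=> [|s {}k Xs _ IH|s {}k Xs _ IH]; first by rewrite op1.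
    by rewrite opM IH opE /rstep (rstepL _ _ gb0 (b0X s Xs)).
  by rewrite opM IH opV /rstepV (rstepL _ _ gb0 (b0X s Xs)).
have onY k : gen Y k -> gen (predI X Y) (op k (1, b0)).1 /\
    exists2 w, all Y w & forall x, (op k (1, b0)).2 x = act m w (e x).
  have YX w (b : state) s x : all Y w -> (forall x, b x = act m w (e x)) -> Y s ->
      label s b = Some x -> (predI X Y) x.
    move=> Yw bw Ys /labelK[Xx bx]; rewrite /= Xx /=; apply/negPn/negP => Yx.
    have := act_support m (e x) Yw Yx; rewrite -bw bx !ffunE eqxx.
    by case: eqP => // xs; rewrite xs Ys in Yx.
  elim=> [|s {}k Ys _ [Ik [w Yw bw]]|s {}k Ys _ [Ik [w Yw bw]]].
  - by rewrite op1; split; [exact: gen_one|exists [::] => // x; rewrite ffunE].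
  - rewrite opM opE; case: (op k _) Ik bw => h b /= Ih bw.
    have [gb|gb] := pselect (good b); last first.
      by rewrite /rstep rstep_bad //; split=> //; exists w.
    case ls: (label s b) => [x|]; rewrite /rstep ?(rstepL _ _ gb ls) ?rstepN //=.
      split; last by exists w.
      by apply: gen_mul => //; exact: (YX w b s x Yw bw Ys ls).
    by split=> //; exists (s :: w) => /= [|x]; rewrite ?Ys // ffunE bw.
  - rewrite opM opV; case: (op k _) Ik bw => h b /= Ih bw.
    have [gb|gb] := pselect (good b); last first.
      by rewrite /rstepV rstep_bad //; split=> //; exists w.
    case ls: (label s b) => [x|]; rewrite /rstepV ?(rstepL _ _ gb ls) ?rstepN //=.
      split; last by exists w.
      by apply: gen_mulV => //; exact: (YX w b s x Yw bw Ys ls).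
    by split=> //; exists (s :: w) => /= [|x]; rewrite ?Ys // ffunE bw.
by move=> /onX Xg /onY[]; rewrite Xg.
Qed.

End Retraction.

Lemma gen_all g : (forall s, gen (predC1 s) g) -> g = 1.
Proof.
move=> h; apply: gen_pred0.
have : gen (fun s => s \notin enum S) g.
  elim: (enum S) => [|s l IH].
    by apply: gen_sub (gen_predT g) => t _; rewrite in_nil.
  apply: gen_sub (gen_inter (h s) IH) => t /=.
  by rewrite in_cons negb_or.
by apply: gen_sub => s; rewrite mem_enum.
Qed.

End Artin.

(** * Amalgams of parabolic subgroups *)

Section Amalgam.
Variables (S : finType) (m : S -> S -> link) (s0 t0 : S).
Hypotheses (mC : forall s t, m s t = m t s) (s0t0 : s0 != t0)
  (m_free : m s0 t0 = Free).

Local Notation A := (artin m).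
Local Notation d := (@agen S m).

Definition edge : A -> Prop := gen (fun s => (s != s0) && (s != t0)).
Definition vertex (b : bool) : A -> Prop := gen (predC1 (if b then s0 else t0)).

Lemma edge_vertex b g : edge g -> vertex b g.
Proof. by apply: gen_sub => s /andP[] /=; case: b. Qed.

Lemma edge_inv g : edge g^-1 -> edge g.
Proof. by move/genV; rewrite invgK. Qed.

Lemma edgeMl c g : edge c -> edge (c * g) <-> edge g.
Proof.
move=> Cc; split=> [|Cg]; last exact: genM.
by move/(genM (genV Cc)); rewrite mulKg.
Qed.

Lemma edgeMr c g : edge c -> edge (g * c) <-> edge g.
Proof.
move=> Cc; split=> [Cg|Cg]; last exact: genM.
by rewrite -(mulgK c g); apply: genM Cg (genV Cc).
Qed.

Definition coset_rep (g : A) : A := choose (fun r : A => `[< edge (r * g^-1) >]) g.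

Lemma coset_repP g : edge (coset_rep g * g^-1).
Proof.
apply/asboolP; apply: (@chooseP _ (fun r : A => `[< edge (r * g^-1) >])).
by apply/asboolP; rewrite mulgV; exact: gen_one.
Qed.

Lemma coset_rep_mull c g : edge c -> coset_rep (c * g) = coset_rep g.
Proof.
move=> Cc; rewrite /coset_rep.
have E (r : A) : `[< edge (r * (c * g)^-1) >] = `[< edge (r * g^-1) >].
  by apply: asbool_equiv_eq; rewrite invgM mulgA; apply: edgeMr; exact: genV.
rewrite (eq_choose E); apply: choose_id; apply/asboolP.
  by rewrite mulgK.
by rewrite mulgV; exact: gen_one.
Qed.

Lemma coset_rep_id g : coset_rep (coset_rep g) = coset_rep g.
Proof.
by rewrite -[X in coset_rep X](mulgVK g) coset_rep_mull //; exact: coset_repP.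
Qed.

(* [(c, [:: (b1, x1); ...; (bk, xk)])] stands for the normal form
   [c * x1 * ... * xk], with [xi] a coset representative in [vertex bi]. *)
Definition nform : Type := (A * seq (bool * A))%type.

Definition lead (l : seq (bool * A)) : option bool :=
  if l is (b, _) :: _ then Some b else None.

Fixpoint reps (l : seq (bool * A)) : Prop :=
  if l is (b, x) :: l' then
    [/\ ~ edge x, coset_rep x = x, lead l' <> Some b & reps l']
  else True.

Definition valid (z : nform) : Prop := edge z.1 /\ reps z.2.

Definition unpack (b : bool) (z : nform) : nform :=
  if z.2 is (b', x) :: l then if b' == b then (z.1 * x, l) else z else z.

Definition pack (b : bool) (z : nform) : nform :=
  if `[< edge z.1 >] then z
  else (z.1 * (coset_rep z.1)^-1, (b, coset_rep z.1) :: z.2).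

Definition opv (b : bool) (g : A) (z : nform) : nform :=
  pack b (g * (unpack b z).1, (unpack b z).2).

Lemma unpackK b z : valid z -> pack b (unpack b z) = z.
Proof.
case: z => c [|[b' x] l] [] /= Cc; first by rewrite /pack asboolT.
case=> nCx rx _ _; rewrite /unpack /=; case: eqP => [->|_]; last first.
  by rewrite /pack asboolT.
rewrite /pack asboolF /=; last by rewrite edgeMl.
by rewrite coset_rep_mull // rx mulgK.
Qed.

Lemma packK b z : lead z.2 <> Some b -> unpack b (pack b z) = z.
Proof.
rewrite /pack /unpack; case: asboolP => _ /=.
  case: z => c [|[b' x] l] //= h; case: eqP => // bb.
  by rewrite bb in h.
by rewrite eqxx mulgVK; case: z.
Qed.

Lemma lead_unpack b z : valid z -> lead (unpack b z).2 <> Some b.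
Proof.
case: z => c [|[b' x] l] [] //= _ [] _ _ lb _; rewrite /unpack /=.
by case: eqP => [<-|bb []].
Qed.

Lemma opvM b g h z : valid z -> opv b g (opv b h z) = opv b (g * h) z.
Proof.
by move=> vz; rewrite /opv packK /= ?mulgA //; exact: lead_unpack.
Qed.

Lemma opv1 b z : valid z -> opv b 1 z = z.
Proof.
by move=> vz; rewrite /opv mul1g -surjective_pairing unpackK.
Qed.

Lemma valid_opv b g z : valid z -> valid (opv b g z).
Proof.
move=> vz; have lz := @lead_unpack b z vz.
have rz : reps (unpack b z).2.
  by case: z vz {lz} => c [|[b' x] l] [] //= _ [*]; rewrite /unpack /=; case: eqP.
rewrite /opv /pack /=; case: asboolP => [Cg|nCg]; first by split.
split=> /=.
  by apply: edge_inv; rewrite invgM invgK; exact: coset_repP.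
split=> //; last exact: coset_rep_id.
move=> Cr; apply: nCg; apply: edge_inv.
by move: (coset_repP (g * (unpack b z).1)); rewrite edgeMl.
Qed.

Lemma opv_edge b c z : edge c -> valid z -> opv b c z = (c * z.1, z.2).
Proof.
move=> Cc vz; rewrite -[X in _ = (_ * X.1, X.2)](unpackK b vz) /opv /pack /=.
case: asboolP => [/edgeMl-/(_ Cc) Cu|nCu]; first by rewrite asboolT.
rewrite asboolF /=; last by move=> Cu; apply: nCu; exact/edgeMl.
by rewrite coset_rep_mull // mulgA.
Qed.

Lemma edge_gen s : s != s0 -> s != t0 -> edge (d s).
Proof. by move=> ss0 st0; apply: gen_agen; rewrite ss0. Qed.

Lemma normal_form_action : exists op : A -> nform -> nform,
  [/\ forall z, op 1 z = z, forall g h z, op (g * h) z = op g (op h z)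
    & forall b g z, vertex b g -> valid z -> op g z = opv b g z].
Proof.
pose f_by (k : S -> A) s z := if `[< valid z >] then opv (s != s0) (k s) z else z.
have fE k s z : valid z -> f_by k s z = opv (s != s0) (k s) z.
  by move=> vz; rewrite /f_by asboolT.
have fN k s z : ~ valid z -> f_by k s z = z by move=> vz; rewrite /f_by asboolF.
have fK k k' s : (forall s, k s * k' s = 1) -> cancel (f_by k' s) (f_by k s).
  move=> kk z; have [vz|vz] := pselect (valid z); last by rewrite !fN.
  rewrite [f_by k' s z]fE // fE; last exact: valid_opv.
  by rewrite opvM // kk opv1.
have one s t z : m s t <> Free -> valid z -> exists b,
    forall z, valid z -> f_by d s z = opv b (d s) z /\ f_by d t z = opv b (d t) z.
  move=> mst _; have [ss|ss] := eqVneq s s0; have [ts|ts] := eqVneq t s0.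
  - by exists false => y vy; rewrite !fE // ss ts eqxx.
  - exists false => y vy; rewrite !fE // ss eqxx (negbTE ts) /=; split=> //.
    have tt : t != t0 by apply: contra_notN mst => /eqP ->; rewrite ss.
    by rewrite !opv_edge //; exact: edge_gen.
  - exists false => y vy; rewrite !fE // ts eqxx (negbTE ss) /=; split=> //.
    have tt : s != t0 by apply: contra_notN mst => /eqP ->; rewrite mC ts.
    by rewrite !opv_edge //; exact: edge_gen.
  - by exists true => y vy; rewrite !fE // ss ts.
have fV k s z : valid z -> valid (f_by k s z).
  by move=> vz; rewrite fE //; exact: valid_opv.
case: (@artin_action S m nform (f_by d) (f_by (fun s => (d s)^-1))).
- by move=> s; apply: fK => x; rewrite mulVg.
- by move=> s; apply: fK => x; rewrite mulgV.
- move=> s t st mst z; have [vz|vz] := pselect (valid z); last by rewrite !fN.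
  have [|b E] := one s t z _ vz; first by rewrite mst.
  have [Es Et] := E z vz; have [Ets _] := E _ (fV d t z vz).
  have [_ Est] := E _ (fV d s z vz).
  by rewrite Ets Est Es Et !opvM // agen_comm.
- move=> s t st mst z; have [vz|vz] := pselect (valid z); last by rewrite !fN.
  have [|b E] := one s t z _ vz; first by rewrite mst.
  have Fs y : valid y -> f_by d s y = opv b (d s) y by move=> /E[].
  have Ft y : valid y -> f_by d t y = opv b (d t) y by move=> /E[].
  rewrite Fs; last exact: fV (fV _ _ _ vz).
  rewrite Ft; last exact: fV.
  rewrite Fs // [RHS]Ft; last exact: fV (fV _ _ _ vz).
  rewrite [f_by d s (f_by d t z)]Fs; last exact: fV.
  rewrite [f_by d t z]Ft //.
  have vs := valid_opv b (d s) vz; have vt := valid_opv b (d t) vz.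
  by rewrite !opvM // agen_braid.
move=> op [op1 opM opE]; exists op; split=> // b g z + vz.
have opV s y : op (d s)^-1 y = f_by (fun s => (d s)^-1) s y.
  have k : cancel (f_by (fun s => (d s)^-1) s) (f_by d s).
    by apply: fK => x; rewrite mulgV.
  by rewrite -[X in op _ X]k -opE -opM mulVg op1.
have tag s y : s != (if b then s0 else t0) -> valid y -> forall h,
    (edge (d s) -> edge h) -> opv (s != s0) h y = opv b h y.
  case: b => [->//|] st vy h Ch; case: eqP => [//|/eqP ss] /=.
  by rewrite !opv_edge //; apply: Ch; exact: edge_gen.
elim=> [|s h sb _ IH|s h sb _ IH]; first by rewrite op1 opv1.
  rewrite opM IH opE fE; last exact: valid_opv.
  by rewrite tag // ?opvM //; exact: valid_opv.
rewrite opM IH opV fE; last exact: valid_opv.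
by rewrite tag // ?opvM //; [exact: valid_opv|move=> Cs; exact: genV].
Qed.

Inductive reduced : nat -> bool -> bool -> A -> Prop :=
| reduced1 b x : vertex b x -> ~ edge x -> reduced 1 b b x
| reducedS k b b' x g : vertex b x -> ~ edge x -> reduced k (~~ b) b' g ->
    reduced k.+1 b b' (x * g).

Lemma reduced_size k b b' g k' c c' :
  reduced k b b' g -> reduced k' c c' g -> k = k'.
Proof.
case: normal_form_action => op [op1 opM opE].
suff E l a a' h : reduced l a a' h -> forall z, valid z -> lead z.2 <> Some a' ->
    [/\ valid (op h z), lead (op h z).2 = Some a & size (op h z).2 = l + size z.2].
  have v0 : valid (1, [::]) by split=> //; exact: gen_one.
  move=> /E/(_ _ v0)[//|_ _ gk] /E/(_ _ v0)[//|_ _]; rewrite gk => /eqP.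
  by rewrite !addn0 => /eqP.
have push c1 x z : vertex c1 x -> ~ edge x -> valid z -> lead z.2 <> Some c1 ->
    [/\ valid (op x z), lead (op x z).2 = Some c1 & size (op x z).2 = (size z.2).+1].
  move=> Gx nCx vz lz; rewrite (opE c1) //.
  have uz : unpack c1 z = z.
    case: z lz {vz} => z1 [|[b'' y] l'] //=; rewrite /unpack /=.
    by case: eqP => // ->.
  have nCxz : ~ edge (x * z.1) by move/edgeMr; case: vz => [Cz _] /(_ Cz).
  have := valid_opv c1 x vz; rewrite /opv uz => vp.
  by split=> //; rewrite /pack asboolF.
elim=> {l a a' h} [a x Gx nCx|l a a' x h Gx nCx _ IH] z vz lz; first exact: push.
have [vh lh sh] := IH z vz lz; rewrite opM.
have [|? ? ->] := push a x (op h z) Gx nCx vh; first by rewrite lh; case: (a).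
by rewrite sh.
Qed.

Lemma reduced_gt0 k b b' g : reduced k b b' g -> 0 < k.
Proof. by case. Qed.

Lemma reduced_mull c k b b' g : edge c -> reduced k b b' g -> reduced k b b' (c * g).
Proof.
move=> Cc; case=> {k b b' g} [b x Gx nCx|k b b' x g Gx nCx Rg].
  apply: reduced1; first by apply: genM Gx; exact: edge_vertex.
  by rewrite edgeMl.
rewrite mulgA; apply: reducedS Rg; first by apply: genM Gx; exact: edge_vertex.
by rewrite edgeMl.
Qed.

Lemma reduced_cat k b b' g k' b'' h :
  reduced k b b' g -> reduced k' (~~ b') b'' h -> reduced (k + k') b b'' (g * h).
Proof.
move=> Rg Rh; elim: Rg Rh => {k b b' g} [b x Gx nCx|k b b' x g Gx nCx _ IH] Rh.
  exact: reducedS.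
by rewrite -mulgA; apply: reducedS => //; exact: IH.
Qed.

Lemma reduced_inv k b b' g : reduced k b b' g -> reduced k b' b g^-1.
Proof.
have inv1 b1 x : vertex b1 x -> ~ edge x -> reduced 1 b1 b1 x^-1.
  by move=> Gx nCx; apply: reduced1; [exact: genV|move/edge_inv].
elim=> {k b b' g} [b x Gx nCx|k b b' x g Gx nCx _ IH]; first exact: inv1.
rewrite invgM -addn1; apply: reduced_cat IH _.
by rewrite negbK; exact: inv1.
Qed.

Lemma reduced_uncons k b b' g : reduced k b b' g -> b != b' -> exists l x y,
  [/\ g = x * y, vertex b x, ~ edge x & reduced l (~~ b) b' y].
Proof.
case=> {k b b' g} [b x _ _|k b b' x g Gx nCx Rg] bb; first by rewrite eqxx in bb.
by exists k, x, g.
Qed.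

Lemma edge_or_reduced g : edge g \/ exists k b b', reduced k b b' g.
Proof.
have mulv b x h : vertex b x -> edge h \/ (exists k b b', reduced k b b' h) ->
    edge (x * h) \/ exists k b b', reduced k b b' (x * h).
  move=> Gx; have [Cx|nCx] := pselect (edge x).
    case=> [Ch|[k [c [c' Rh]]]]; first by left; apply: genM.
    by right; exists k, c, c'; exact: reduced_mull.
  case=> [Ch|[k [c [c' Rh]]]].
    right; exists 1%N, b, b; apply: reduced1; last by rewrite edgeMr.
    by apply: genM Gx _; exact: edge_vertex.
  have [cb|cb] := eqVneq c b; last first.
    have {}cb : c = ~~ b by move: cb; case: (b); case: (c).
    by right; exists k.+1, b, c'; apply: reducedS; rewrite -?cb.
  rewrite {c}cb in Rh; case: Rh Gx => {k b c' h} [b y Gy nCy|k b b' y h Gy nCy Rh] Gx.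
    have [Cxy|nCxy] := pselect (edge (x * y)); first by left.
    by right; exists 1%N, b, b; apply: reduced1 => //; exact: genM.
  rewrite mulgA; have [Cxy|nCxy] := pselect (edge (x * y)).
    by right; exists k, (~~ b), b'; exact: reduced_mull.
  by right; exists k.+1, b, b'; apply: reducedS => //; exact: genM.
have vgen s : exists b, vertex b (d s).
  have [ss|ss] := eqVneq s s0; last by exists true; apply: gen_agen.
  by exists false; apply: gen_agen; rewrite /= ss.
elim/artin_ind: g => [|s h IH|s h IH]; first by left; exact: gen_one.
  by have [b Gs] := vgen s; exact: mulv Gs IH.
by have [b Gs] := vgen s; exact: mulv (genV Gs) IH.
Qed.

Lemma edge_expg s k : s \in [:: s0; t0] -> edge (d s ^+ k.+1) -> False.
Proof.
move=> ss Cs; suff /gen_pred0/agen_expg : gen pred0 (d s ^+ k.+1) by [].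
have := gen_inter mC (gen_pred1 m s k.+1) Cs.
apply: gen_sub => u /= /andP[/eqP ->].
by move: ss; rewrite !inE => /orP[] /eqP ->; rewrite eqxx ?andbF.
Qed.

Lemma vertex_s0 k : vertex false (d s0 ^+ k).
Proof. by apply: gen_sub (gen_pred1 m s0 k) => s /= /eqP ->. Qed.

Lemma reduced_false_s0 : reduced 1 false false (d s0).
Proof.
apply: reduced1; first by have := vertex_s0 1; rewrite expg1.
by rewrite -[d s0]expg1; apply: edge_expg; rewrite !inE eqxx.
Qed.

Lemma reduced_true_t0 : reduced 1 true true (d t0).
Proof.
apply: reduced1; first by apply: gen_agen; rewrite /= eq_sym.
by rewrite -[d t0]expg1; apply: edge_expg; rewrite !inE eqxx orbT.
Qed.

(* The edge group has more than two cosets in [vertex false], as witnessed by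
   the powers of [s0]; hence a conjugate of [g] has both ends of the same kind. *)
Lemma same_ends (P : A -> Prop) g b :
    (forall x, P x -> P x^-1) -> (forall x y, P x -> P (y * x * y^-1)) ->
    P g -> ~ edge g -> exists k x, P x /\ reduced k b b x.
Proof.
move=> Pinv Pconj Pg nCg.
suff [k [x [a [Px Rx]]]] : exists k x a, P x /\ reduced k a a x.
  have [<-|ab] := eqVneq a b; first by exists k, x.
  have {}ab : b = ~~ a by move: ab; case: (a); case: (b).
  have [y Ry] : exists y, reduced 1 b b y.
    by case: (b); eexists; [exact: reduced_true_t0|exact: reduced_false_s0].
  exists (1 + k + 1)%N, (y * x * y^-1); split; first exact: Pconj.
  apply: (@reduced_cat _ b a _ _ b); last by rewrite -ab; exact: reduced_inv.
  by apply: reduced_cat Ry _; rewrite ab negbK.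
have [//|[k [a [a' Rg]]]] := edge_or_reduced g.
have [aa|aa] := eqVneq a a'; first by exists k, g, a; rewrite {2}aa.
have [h [Ph Rh]] : exists h, P h /\ reduced k false true h.
  move: aa Rg; case: a => //; case: a' => // _ Rg; last by exists g.
  by exists g^-1; split; [exact: Pinv|exact: reduced_inv].
have {Rh} [l [x [y [hE Gx nCx Ry]]]] : exists l x y,
    [/\ h = x * y, vertex false x, ~ edge x & reduced l true true y].
  exact: reduced_uncons Rh _.
have [i nCi] : exists i, ~ edge (d s0 ^+ i.+1 * x).
  have [C1|nC1] := pselect (edge (d s0 ^+ 1 * x)); last by exists 0%N.
  exists 1%N; rewrite expgS -mulgA; move/(genM)=> /(_ _ (genV C1)); rewrite mulgK.
  by rewrite -[d s0]expg1; apply: edge_expg; rewrite !inE eqxx.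
pose z := d s0 ^+ i.+1; exists (l.+1 + 1)%N, (z * h * z^-1), false.
split; first exact: Pconj.
have Gz : vertex false z by exact: vertex_s0.
apply: (@reduced_cat _ false true _ _ false); last first.
  apply: reduced_inv; apply: reduced1 => //.
  by apply: edge_expg; rewrite !inE eqxx.
by rewrite hE mulgA; apply: reducedS => //; exact: genM.
Qed.

Lemma commuting_in_edge (N M : A -> Prop) :
    (forall x, N x -> N x^-1) -> (forall x y, N x -> N (y * x * y^-1)) ->
    (forall x, M x -> M x^-1) -> (forall x y, M x -> M (y * x * y^-1)) ->
    (forall x y, N x -> M y -> x * y = y * x) ->
  (forall x, N x -> edge x) \/ (forall x, M x -> edge x).
Proof.
move=> Ninv Nconj Minv Mconj NM.
have [|/existsNP[n /not_implyP[Nn nCn]]] := pselect (forall x, N x -> edge x).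
  by left.
have [|/existsNP[x /not_implyP[Mx nCx]]] := pselect (forall x, M x -> edge x).
  by right.
have [k [n' [Nn' Rn]]] := same_ends true Ninv Nconj Nn nCn.
have [l [x' [Mx' Rx]]] := same_ends false Minv Mconj Mx nCx.
have R : reduced (k + l + k) true true (n'^-1 * x' * n').
  by apply: (reduced_cat (b' := false) _ Rn); apply: (reduced_cat (reduced_inv Rn) Rx).
rewrite -mulgA -(NM n' x') // mulKg in R.
by have := reduced_size R Rx; have := reduced_gt0 Rn; lia.
Qed.

End Amalgam.

(** * The symmetric quotient of the virtual braid group *)

Section SymmetricPart.
Variable p : nat.

Local Notation n := p.+2.
Local Notation G := (virtual_braid_group n).
Local Notation I := 'I_n.-1.

Definition sg (i : I) : G := @pres_gen _ (@vb_rel n) (Sigma i : vb_gen n).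
Definition tu (i : I) : G := @pres_gen _ (@vb_rel n) (Tau i : vb_gen n).

Definition lo (i : I) : 'I_n := widen_ord (leq_pred n) i.
Definition hi (i : I) : 'I_n := lift ord0 i.
Definition adj (i : I) : {perm 'I_n} := tperm (lo i) (hi i).

Lemma loE i : lo i = i :> nat. Proof. by []. Qed.

Lemma hiE i : hi i = i.+1 :> nat. Proof. exact: lift0. Qed.

Lemma lo_hi i : lo i != hi i.
Proof. by apply/eqP => /(congr1 (@nat_of_ord n)); rewrite hiE loE; lia. Qed.

Lemma vb_relE u v : @vb_rel n u v ->
  \pi_(presented (@vb_rel n)) u = \pi_(presented (@vb_rel n)) v.
Proof. by move=> r; apply/presentedP/pres_rel. Qed.

Lemma vb_ind (P : G -> Prop) :
    P 1 -> (forall i g, P g -> P (sg i * g)) ->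
    (forall i g, P g -> P ((sg i)^-1 * g)) ->
    (forall i g, P g -> P (tu i * g)) -> (forall i g, P g -> P ((tu i)^-1 * g)) ->
  forall g, P g.
Proof.
move=> P1 Ps PsV Pt PtV; apply: pres_ind => [|[] i g|[] i g] //.
- exact: Ps.
- exact: Pt.
- exact: PsV.
- exact: PtV.
Qed.

Lemma tu_invol i : tu i * tu i = 1.
Proof. by have h := vb_relE (VB2_invol i); rewrite pi_cat in h; exact: h. Qed.

Lemma tuV i : (tu i)^-1 = tu i.
Proof. by apply: (mulgI (tu i)); rewrite mulgV tu_invol. Qed.

Lemma tu_braid (i j : I) : j = i.+1 :> nat -> tu i * tu j * tu i = tu j * tu i * tu j.
Proof.
move=> ij; have h := vb_relE (VB2_braid (i := i) (j := j) ij).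
by rewrite !pi_cat !mulgA in h; exact: h.
Qed.

Lemma tu_far (i j : I) : far i j -> tu i * tu j = tu j * tu i.
Proof.
move=> ij; have h := vb_relE (VB2_comm (i := i) (j := j) ij).
by rewrite !pi_cat in h; exact: h.
Qed.

Lemma sg_braid (i j : I) : j = i.+1 :> nat -> sg i * sg j * sg i = sg j * sg i * sg j.
Proof.
move=> ij; have h := vb_relE (VB1_braid (i := i) (j := j) ij).
by rewrite !pi_cat !mulgA in h; exact: h.
Qed.

Lemma sg_far (i j : I) : far i j -> sg i * sg j = sg j * sg i.
Proof.
move=> ij; have h := vb_relE (VB1_comm (i := i) (j := j) ij).
by rewrite !pi_cat in h; exact: h.
Qed.

Lemma sg_shift (i j : I) : j = i.+1 :> nat -> tu i * tu j * sg i = sg j * tu i * tu j.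
Proof.
move=> ij; have h := vb_relE (VB3_braid (i := i) (j := j) ij).
by rewrite !pi_cat !mulgA in h; exact: h.
Qed.

Lemma sg_tu_far (i j : I) : far i j -> sg i * tu j = tu j * sg i.
Proof.
move=> ij; have h := vb_relE (VB3_comm (i := i) (j := j) ij).
by rewrite !pi_cat in h; exact: h.
Qed.

Lemma adj_invol i : adj i * adj i = 1.
Proof. exact: tperm2. Qed.

Lemma adj_lo i : adj i (lo i) = hi i. Proof. exact: tpermL. Qed.
Lemma adj_hi i : adj i (hi i) = lo i. Proof. exact: tpermR. Qed.

Lemma adj_id (i : I) (x : 'I_n) : x != i :> nat -> x != i.+1 :> nat -> adj i x = x.
Proof.
move=> xi xj; apply: tpermD; by rewrite eq_sym -val_eqE.
Qed.

Lemma hi_lo (i j : I) : j = i.+1 :> nat -> hi i = lo j.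
Proof. by move=> ij; apply: ord_inj; rewrite hiE loE ij. Qed.

Lemma adj_far (i j : I) : far i j -> adj i * adj j = adj j * adj i.
Proof.
move=> ij; apply/permP => x; rewrite !permM.
have E (k l : I) (y : 'I_n) : far k l -> y \in [:: lo k; hi k] -> adj l y = y.
  rewrite /far !inE => kl /orP[] /eqP ->; apply: adj_id; rewrite ?hiE ?loE; lia.
have ji : far j i by rewrite /far orbC; exact: ij.
have F (k l : I) (y : 'I_n) : far k l -> y \in [:: lo k; hi k] ->
    adj l (adj k y) = adj k (adj l y).
  move=> kl yk; rewrite (E k l y) // (E k l) //.
  by move: yk; rewrite !inE => /orP[] /eqP ->; rewrite ?adj_lo ?adj_hi eqxx ?orbT.
have [xi|xi] := boolP (x \in [:: lo i; hi i]); first exact: F.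
have [xj|xj] := boolP (x \in [:: lo j; hi j]); first by rewrite (F j i).
have N k (y : 'I_n) : y \notin [:: lo k; hi k] -> adj k y = y.
  rewrite !inE negb_or => /andP[y1 y2]; apply: tpermD; by rewrite eq_sym.
by rewrite !N.
Qed.

Lemma adj_braid (i j : I) : j = i.+1 :> nat ->
  adj i * adj j * adj i = adj j * adj i * adj j.
Proof.
move=> ij.
have C k l : adj k * adj l * adj k = tperm (adj k (lo l)) (adj k (hi l)).
  by rewrite -tpermJ /conjg tpermV mulgA.
rewrite !C -{1}(hi_lo ij) adj_hi (hi_lo ij) adj_lo.
by rewrite !adj_id ?hiE ?loE //; lia.
Qed.

Lemma vb_action (Z : Type) (phi phiV : I -> Z * {perm 'I_n} -> Z) :
    let f i y := (phi i y, y.2) in let fV i y := (phiV i y, y.2) in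
    let t i (y : Z * {perm 'I_n}) := (y.1, adj i * y.2) in
    (forall i, cancel (f i) (fV i)) -> (forall i, cancel (fV i) (f i)) ->
    (forall i j : I, j = i.+1 :> nat ->
       forall y, f i (f j (f i y)) = f j (f i (f j y))) ->
    (forall i j : I, far i j -> forall y, f i (f j y) = f j (f i y)) ->
    (forall i j : I, j = i.+1 :> nat ->
       forall y, t i (t j (f i y)) = f j (t i (t j y))) ->
    (forall i j : I, far i j -> forall y, f i (t j y) = t j (f i y)) ->
  exists op : G -> Z * {perm 'I_n} -> Z * {perm 'I_n},
    [/\ forall y, op 1 y = y, forall g h y, op (g * h) y = op g (op h y),
        forall i y, op (sg i) y = f i y & forall i y, op (tu i) y = t i y].
Proof.
move=> f fV t fK fVK fB fC mB mC.
have tK i : cancel (t i) (t i) by move=> [z w]; rewrite /t /= mulgA adj_invol mul1g.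
pose k (x : vb_gen n) := match x with Sigma i => f i | Tau i => t i end.
pose kV (x : vb_gen n) := match x with Sigma i => fV i | Tau i => t i end.
case: (@pres_action _ (@vb_rel n) _ k kV).
- by case=> i /=; [exact: fK|exact: tK].
- by case=> i /=; [exact: fVK|exact: tK].
- move=> _ _ [i j ij|i j ij|i j ij|i j ij|i|i j ij|i j ij] y /=.
  + exact: fB.
  + exact: fC.
  + by rewrite /t /= !mulgA adj_braid.
  + by rewrite /t /= !mulgA adj_far.
  + exact: tK.
  + exact: mB.
  + exact: mC.
move=> op [op1 opM opE]; exists op.
by split=> // i y; [exact: (opE (Sigma i))|exact: (opE (Tau i))].
Qed.

End SymmetricPart.

Section TauWords.
Variable p : nat.

Local Notation n := p.+2.
Local Notation G := (virtual_braid_group n).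
Local Notation I := 'I_n.-1.

Lemma theta_exists : exists theta : G -> {perm 'I_n},
  [/\ theta 1 = 1, forall g h, theta (g * h) = theta g * theta h,
      forall i, theta (sg i) = 1 & forall i, theta (tu i) = adj i].
Proof.
case: (@vb_action p unit (fun _ _ => tt) (fun _ _ => tt)).
- by move=> i [[] w].
- by move=> i [[] w].
- by [].
- by [].
- by [].
- by [].
move=> op [op1 opM opS opT].
have E g z w : op g (z, w) = (tt, (op g (tt, 1)).2 * w).
  have KS i : cancel (op (sg i)) (op (sg i)^-1).
    by move=> y; rewrite -opM mulVg op1.
  have KT i : cancel (op (tu i)) (op (tu i)^-1).
    by move=> y; rewrite -opM mulVg op1.
  have VS i y : op (sg i)^-1 y = (tt, y.2).
    by rewrite -[RHS](KS i) opS; case: y => [[] w'].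
  elim/vb_ind: g z w => [|i g IH|i g IH|i g IH|i g IH] z w.
  - by rewrite !op1 mul1g; case: z.
  - by rewrite !opM IH !opS.
  - by rewrite !opM IH !VS.
  - by rewrite !opM IH !opT /= mulgA.
  - by rewrite tuV !opM IH !opT /= mulgA.
exists (fun g => (op g (tt, 1)).2); split=> [|g h|i|i].
- by rewrite op1.
- by rewrite opM; case: (op h _) => z w; rewrite E.
- by rewrite opS.
- by rewrite opT /= mulg1.
Qed.

Definition theta : G -> {perm 'I_n} := sval (cid theta_exists).

Lemma theta1 : theta 1 = 1. Proof. by case: (svalP (cid theta_exists)). Qed.
Lemma thetaM g h : theta (g * h) = theta g * theta h.
Proof. by case: (svalP (cid theta_exists)). Qed.
Lemma theta_tu i : theta (tu i) = adj i.
Proof. by case: (svalP (cid theta_exists)). Qed.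
Lemma thetaV g : theta g^-1 = (theta g)^-1.
Proof. by apply: (mulgI (theta g)); rewrite -thetaM !mulgV theta1. Qed.

Definition ev (u : seq I) : G := foldr (fun i g => tu i * g) 1 u.

Lemma ev_cat u v : ev (u ++ v) = ev u * ev v.
Proof. by elim: u => [|i u IH] /=; rewrite ?mul1g // IH mulgA. Qed.

Lemma ev_rev u : ev (rev u) = (ev u)^-1.
Proof.
elim: u => [|i u IH]; first by rewrite invg1.
by rewrite rev_cons -cats1 ev_cat IH /= mulg1 invgM tuV.
Qed.

(* MathComp permutations compose from left to right: the inverse makes this a
   left action on the strands. *)
Definition wperm (g : G) : {perm 'I_n} := (theta g)^-1.

Lemma wpermM g h x : wperm (g * h) x = wperm g (wperm h x).
Proof. by rewrite /wperm thetaM invgM permM. Qed.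

Lemma wperm1 x : wperm 1 x = x.
Proof. by rewrite /wperm theta1 invg1 perm1. Qed.

Lemma wperm_tu i x : wperm (tu i) x = adj i x.
Proof. by rewrite /wperm theta_tu tpermV. Qed.

Lemma wperm_rcons u i x : wperm (ev (rcons u i)) x = wperm (ev u) (adj i x).
Proof. by rewrite -cats1 ev_cat wpermM /= mulg1 wperm_tu. Qed.

Definition ilink (i j : I) : link := if far i j then Comm else Braid.

Lemma far_or_adjacent (i j : I) :
  i != j -> far i j = false -> j = i.+1 :> nat \/ i = j.+1 :> nat.
Proof. by rewrite /far -val_eqE /=; lia. Qed.

Lemma adj_far_id (i j : I) (x : 'I_n) :
  far i j -> x \in [:: lo i; hi i] -> adj j x = x.
Proof.
by rewrite /far !inE => ij /orP[] /eqP ->; apply: adj_id; rewrite ?hiE ?loE; lia.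
Qed.

Lemma tau_pos_or_shrinks (u : seq I) (k : I) :
  wperm (ev u) (lo k) < wperm (ev u) (hi k) \/
  shrinks (fun u v => ev u = ev v) u k.
Proof.
apply: (@pos_or_shrinks _ ilink (fun u v => ev u = ev v)
  (fun u k => wperm (ev u) (lo k) < wperm (ev u) (hi k))).
- by move=> i j; rewrite /ilink /far orbC.
- by [].
- by [].
- by move=> ? ? ? -> ->.
- by move=> v w x vw; rewrite !ev_cat vw.
- by move=> v i; rewrite ev_cat /= mulg1 tu_invol mulg1.
- move=> v i j _; rewrite /ilink; case: ifP => // ij _.
  by rewrite !ev_cat /= !mulg1 tu_far.
- move=> v i j ij; rewrite /ilink; case: ifP => // fij _.
  rewrite !ev_cat /= !mulg1; congr (_ * _); rewrite !mulgA.
  by case: (far_or_adjacent ij fij) => E; [exact: tu_braid|exact: esym (tu_braid E)].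
- by move=> v w i ->.
- by move=> i; rewrite !wperm1 loE hiE.
move=> v i j l ij pi pj; rewrite /ilink; case: ifP => fij.
  case: l => [|[|//]] /= _; first by rewrite cats0.
  rewrite cats1 !wperm_rcons.
  by rewrite !(adj_far_id fij) // !inE eqxx ?orbT.
have cat2 x : wperm (ev (v ++ [:: i; j])) x = wperm (ev v) (adj i (adj j x)).
  by rewrite -cat1s catA !cats1 !wperm_rcons.
case: l => [|[|[|//]]] /= _; first by rewrite cats0.
  rewrite cats1 !wperm_rcons; case: (far_or_adjacent ij fij) => E.
    rewrite (adj_id (x := lo i)) ?loE; try lia.
    by rewrite (hi_lo E) adj_lo (ltn_trans pi) // (hi_lo E).
  rewrite -(hi_lo E) adj_hi (adj_id (x := hi i)) ?hiE; try lia.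
  by rewrite (ltn_trans pj) // (hi_lo E).
rewrite !cat2; case: (far_or_adjacent ij fij) => E.
- rewrite (adj_id (x := lo i)) ?loE; try lia.
  rewrite adj_lo (hi_lo E) adj_lo (adj_id (x := hi j)) ?hiE //; lia.
- rewrite (adj_id (i := j) (x := hi i)) ?hiE; try lia.
  rewrite adj_hi -(hi_lo E) adj_hi (adj_id (i := i)) ?loE //; lia.
Qed.

(* A minimal word never shortens at its last letter [k], so its permutation
   inverts [k] and [k+1]; this is impossible for [k < c]. *)
Lemma tau_word_fix c u : (forall x : 'I_n, x < c -> wperm (ev u) x = x) ->
  exists2 v, ev v = ev u & all (fun k : I => c <= k) v.
Proof.
have [l] := ubnP (size u); elim: l u => // l IH u; rewrite ltnS => ul fu.
case/lastP: u ul fu => [|u k] ul fu; first by exists [::].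
rewrite size_rcons in ul.
case: (tau_pos_or_shrinks u k) => [pk|[v vu Ev]]; last first.
  rewrite cats1 in Ev; case: (IH v); rewrite ?Ev //; first exact: ltn_trans vu _.
  by move=> w wv cw; exists w.
have kc : c <= k.
  rewrite leqNgt; apply/negP => kc.
  have flo := fu (lo k) kc; rewrite wperm_rcons adj_lo in flo.
  have fhi : wperm (ev u) (lo k) = wperm (ev (rcons u k)) (hi k).
    by rewrite wperm_rcons adj_hi.
  rewrite flo fhi in pk.
  have low : wperm (ev (rcons u k)) (hi k) < c by apply: ltn_trans kc.
  have := perm_inj (fu _ low); move: pk => + E; rewrite E loE hiE; lia.
have fu' (x : 'I_n) : x < c -> wperm (ev u) x = x.
  move=> xc; rewrite -[RHS]fu // wperm_rcons adj_id //; first lia.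
  lia.
have [v Ev cv] := IH u ul fu'.
exists (rcons v k); last by rewrite all_rcons kc.
by rewrite -!cats1 !ev_cat Ev.
Qed.

Lemma tau_word_faithful u : wperm (ev u) = 1 -> ev u = 1.
Proof.
move=> u1; case: (@tau_word_fix n u) => [x _|[|k v]]; first by rewrite u1 perm1.
  by move=> <-.
by move=> _ /= /andP[]; rewrite leqNgt (leqW (ltn_ord k)).
Qed.

Lemma commute_sg0 u : wperm (ev u) (lo ord0) = lo ord0 ->
  wperm (ev u) (hi ord0) = hi ord0 -> ev u * sg ord0 = sg ord0 * ev u.
Proof.
move=> u0 u1; case: (@tau_word_fix 2 u) => [[[|[|//]] ix] _|v <-].
- by have -> : Ordinal ix = lo (ord0 : I) by exact: ord_inj.
- by have -> : Ordinal ix = hi (ord0 : I) by exact: ord_inj.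
elim: v => [|k v IH] /=; first by rewrite mulg1 mul1g.
case/andP=> k2 /IH {}IH; rewrite -mulgA IH !mulgA; congr (_ * _).
by rewrite sg_tu_far // /far /= add0n k2.
Qed.

Lemma sg_from_sg0 (k : I) : exists c, [/\ sg k = ev c * sg ord0 * (ev c)^-1,
  wperm (ev c) (lo ord0) = lo k & wperm (ev c) (hi ord0) = hi k].
Proof.
case: k => k; elim: k => [|k IH] kn.
  exists [::]; rewrite /= invg1 mulg1 mul1g !wperm1.
  by split; [congr sg|congr lo|congr hi]; exact: ord_inj.
have kn' : k < n.-1 by exact: ltnW.
have [c [Ec c0 c1]] := IH kn'.
set i := Ordinal kn' in Ec c0 c1 *; set j := Ordinal kn.
have ij : j = i.+1 :> nat by [].
exists [:: i, j & c]; rewrite /= !wpermM !wperm_tu c0 c1; split.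
- rewrite !invgM !mulgA !tuV -[LHS](mulgK (tu i * tu j)) -[RHS]mulgA.
  rewrite !mulgA -sg_shift // Ec invgM !tuV !mulgA.
  by [].
- by rewrite (adj_id (x := lo i)) ?loE; [rewrite adj_lo (hi_lo ij)|lia|lia].
- by rewrite (hi_lo ij) adj_lo adj_id // hiE /=; lia.
Qed.

Lemma conj_sg_eq u v k l : wperm (ev u) (lo k) = wperm (ev v) (lo l) ->
    wperm (ev u) (hi k) = wperm (ev v) (hi l) ->
  ev u * sg k * (ev u)^-1 = ev v * sg l * (ev v)^-1.
Proof.
have [c [-> <- <-]] := sg_from_sg0 k; have [c' [-> <- <-]] := sg_from_sg0 l.
rewrite -!wpermM -!ev_cat => E0 E1.
have E w w' : ev w * (ev w' * sg ord0 * (ev w')^-1) * (ev w)^-1 =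
    ev (w ++ w') * sg ord0 * (ev (w ++ w'))^-1.
  by rewrite ev_cat invgM !mulgA.
rewrite !E; set w := u ++ c in E0 E1 *; set w' := v ++ c' in E0 E1 *.
have C : ev (rev w' ++ w) * sg ord0 = sg ord0 * ev (rev w' ++ w).
  by apply: commute_sg0; rewrite ev_cat wpermM ?E0 ?E1 -wpermM ev_rev mulVg wperm1.
have -> : ev w = ev w' * ev (rev w' ++ w) by rewrite ev_cat ev_rev mulVKg.
by rewrite -[_ * _ * sg ord0]mulgA C invgM !mulgA mulgK.
Qed.

Lemma tperm_is_tau (i j : 'I_n) : exists u, theta (ev u) = tperm i j.
Proof.
wlog ij : i j / i < j.
  case: (ltngtP i j) => [ij|ji|/ord_inj ->] h; first exact: h.
    by have [u Eu] := h j i ji; exists u; rewrite tpermC.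
  by exists [::]; rewrite theta1 tperm1.
case: j ij => j jn /=; elim: j jn => // j IH jn ij.
have jn' : j < n.-1 by [].
pose k : I := Ordinal jn'.
have hk : hi k = Ordinal jn by apply: ord_inj; rewrite hiE.
have [ij'|ij'] := ltnP i j; last first.
  exists [:: k]; rewrite /= mulg1 theta_tu /adj hk; congr tperm.
  by apply: ord_inj; rewrite loE /=; lia.
have [u Eu] := IH (ltnW jn) ij'.
exists (k :: rcons u k); rewrite /= -cats1 ev_cat /= mulg1 !thetaM Eu !theta_tu.
have -> : tperm i (Ordinal (ltnW jn)) = tperm i (lo k).
  by congr tperm; exact: ord_inj.
rewrite -hk -(adj_lo k) -[in RHS](@adj_id _ k i) //=; try lia.
by rewrite -tpermJ /conjg tpermV mulgA.
Qed.

Lemma theta_tau_surj (w : {perm 'I_n}) : exists u, theta (ev u) = w.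
Proof.
case: (prod_tpermP w) => ts -> _; elim: ts => [|[i j] ts [u Eu]].
  by exists [::]; rewrite big_nil theta1.
have [v Ev] := tperm_is_tau i j.
by exists (v ++ u); rewrite big_cons ev_cat thetaM Ev Eu.
Qed.

End TauWords.

(** * The pure subgroup *)

Lemma perm_extends (T : finType) (xs ys : seq T) :
  uniq xs -> uniq ys -> size xs = size ys -> exists w : {perm T}, map w xs = ys.
Proof.
elim: xs ys => [|x xs IH] [|y ys] //=; first by exists 1.
move=> /andP[xxs uxs] /andP[yys uys] [sz].
have [w wE] := IH ys uxs uys sz; exists (w * tperm (w x) y).
rewrite permM tpermL -wE; congr (_ :: _); apply/eq_in_map => z zxs.
rewrite permM tpermD //.
  by apply/eqP => /perm_inj xz; rewrite xz zxs in xxs.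
by apply/eqP => yz; rewrite yz -wE map_f in yys.
Qed.

Lemma conjgM_left (G : groupType) (g x y : G) :
  g * x * g^-1 * (g * y * g^-1) = g * (x * y) * g^-1.
Proof. by rewrite !mulgA mulgVK. Qed.

Section PureSubgroup.
Variable p : nat.

Local Notation n := p.+2.
Local Notation G := (virtual_braid_group n).
Local Notation I := 'I_n.-1.
Local Notation S := {x : 'I_n * 'I_n | x.1 != x.2}.

Definition pact (w : {perm 'I_n}) (s : S) : S :=
  Sub (w (val s).1, w (val s).2) (contra_neq (@perm_inj _ w _ _) (valP s)).

Definition base (i : I) : S := Sub (lo i, hi i) (lo_hi i).

Lemma pactM (v w : {perm 'I_n}) s : pact (v * w) s = pact w (pact v s).
Proof. by apply: val_inj; rewrite /= !permM. Qed.

Lemma pact1 s : pact 1 s = s.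
Proof. by apply: val_inj; rewrite /= !perm1; case: (val s). Qed.

Lemma pact_wpermM g h s : pact (wperm (g * h)) s = pact (wperm g) (pact (wperm h) s).
Proof. by rewrite -pactM; congr pact; apply/permP => x; rewrite wpermM permM. Qed.

Definition plink (s t : S) : link :=
  let: (i, j) := val s in let: (k, l) := val t in
  if uniq [:: i; j; k; l] then Comm
  else if (j == k) && (i != l) || (l == i) && (k != j) then Braid else Free.

Lemma plinkC s t : plink s t = plink t s.
Proof.
rewrite /plink; case: (val s) => i j; case: (val t) => k l.
have -> : uniq [:: i; j; k; l] = uniq [:: k; l; i; j].
  by rewrite -(rot_uniq 2 [:: i; j; k; l]).
by rewrite orbC.
Qed.

Lemma plink_pact (w : {perm 'I_n}) s t : plink (pact w s) (pact w t) = plink s t.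
Proof.
rewrite /plink /=; case: (val s) => i j; case: (val t) => k l /=.
by rewrite !inE !(inj_eq (@perm_inj _ w)).
Qed.

Lemma plink_neq s t : plink s t <> Free -> s != t.
Proof.
apply: contra_not_neq => ->; rewrite /plink; have := valP t.
case: (val t) => i j /= ij; rewrite !inE eqxx orbT /=.
by rewrite [j == i]eq_sym (negbTE ij).
Qed.

Lemma base_braid (i j : I) : j = i.+1 :> nat -> plink (base i) (base j) = Braid.
Proof.
move=> ij; rewrite /plink /= !inE -(hi_lo ij) eqxx /= andbF.
suff -> : lo i != hi j by [].
by apply/eqP => /(congr1 (@nat_of_ord n)); rewrite hiE loE; lia.
Qed.

Lemma base_comm (i j : I) : far i j -> plink (base i) (base j) = Comm.
Proof.
move=> ij; rewrite /plink /= ifT // !inE.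
rewrite -!(inj_eq (@ord_inj n)) !hiE !loE; move: ij; rewrite /far; lia.
Qed.

Lemma base_shift (i j : I) : j = i.+1 :> nat ->
  pact (adj j) (pact (adj i) (base j)) = base i.
Proof.
move=> ij; apply: val_inj; rewrite /= -(hi_lo ij) adj_hi.
rewrite (@adj_id _ i (hi j)) ?hiE ?adj_hi -?(hi_lo ij); try lia.
by congr pair; apply: adj_id; rewrite loE; lia.
Qed.

Lemma base_far (i j : I) : far i j -> pact (adj j) (base i) = base i.
Proof.
by move=> ij; apply: val_inj; rewrite /= !(adj_far_id ij) // !inE eqxx ?orbT.
Qed.

Lemma plink_braidP s t : plink s t = Braid ->
  ((val s).2 = (val t).1 /\ (val s).1 != (val t).2) \/
  ((val t).2 = (val s).1 /\ (val t).1 != (val s).2).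
Proof.
rewrite /plink; case: (val s) => i j; case: (val t) => k l.
case: ifP => // _; case: ifP => // /orP[] /andP[/eqP ? ?] _; first by left.
by right.
Qed.

Lemma frame (xs ys : seq 'I_n) : uniq xs -> uniq ys -> size xs = size ys ->
  exists u, map (wperm (ev u)) xs = ys.
Proof.
move=> uxs uys sz; have [w wE] := perm_extends uxs uys sz.
by have [u Eu] := theta_tau_surj w^-1; exists u; rewrite /wperm Eu invgK.
Qed.

Lemma base0_reach (s : S) : exists u, pact (wperm (ev u)) (base ord0) = s.
Proof.
have [||u [u0 u1]] :=
  @frame [:: lo ord0; hi ord0] [:: (val s).1; (val s).2] _ _ (erefl _).
- by rewrite cons_uniq inE lo_hi.
- by rewrite cons_uniq inE (valP s).
by exists u; apply: val_inj; rewrite /= u0 u1; case: (val s).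
Qed.

Lemma delta_exists (s : S) : exists g : G, forall u k,
  pact (wperm (ev u)) (base k) = s -> g = ev u * sg k * (ev u)^-1.
Proof.
have [v <-] := base0_reach s; exists (ev v * sg ord0 * (ev v)^-1) => u k.
by move=> /(congr1 val) [u0 u1]; exact: conj_sg_eq.
Qed.

Definition delta (s : S) : G := sval (cid (delta_exists s)).

Lemma deltaE u k s :
  pact (wperm (ev u)) (base k) = s -> delta s = ev u * sg k * (ev u)^-1.
Proof. exact: (svalP (cid (delta_exists s))). Qed.

Lemma delta_base k : delta (base k) = sg k.
Proof.
rewrite (@deltaE [::] k) ?invg1 /= ?mulg1 ?mul1g //.
by rewrite /= -[RHS]pact1; congr pact; apply/permP => x; rewrite wperm1 perm1.
Qed.

Lemma delta_conj u s :
  ev u * delta s * (ev u)^-1 = delta (pact (wperm (ev u)) s).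
Proof.
have [v <-] := base0_reach s; rewrite (@deltaE v ord0) //.
rewrite (@deltaE (u ++ v) ord0); last by rewrite ev_cat pact_wpermM.
by rewrite ev_cat invgM !mulgA.
Qed.

Lemma delta_braid s t : plink s t = Braid ->
  delta s * delta t * delta s = delta t * delta s * delta t.
Proof.
wlog st : s t / (val s).2 = (val t).1 /\ (val s).1 != (val t).2.
  move=> h mst; case: (plink_braidP mst) => st; first exact: h.
  by apply: esym; apply: h; rewrite // plinkC.
case: st => st1 st2 _.
have us := valP s; have ut := valP t.
set i := (val s).1 in us st2 *; set j := (val s).2 in us st1 *.
set l := (val t).2 in ut st2 *; rewrite -st1 in ut.
have uijl : uniq [:: i; j; l] by rewrite !cons_uniq !inE negb_or us st2 ut.
have p1 : 1 < n.-1.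
  have := max_card (mem [:: i; j; l]); rewrite card_ord (card_uniqP uijl) /=; lia.
pose k1 : I := Ordinal p1.
have k01 : hi ord0 = lo k1 by exact: hi_lo.
have u012 : uniq [:: lo ord0; hi ord0; hi k1] by [].
have [u [u0 u1 u2]] := frame u012 uijl (erefl _).
rewrite (@deltaE u ord0 s) ?(@deltaE u k1 t).
- by rewrite !conjgM_left sg_braid.
- by apply: val_inj; rewrite /= -k01 u1 u2 st1 -surjective_pairing.
- by apply: val_inj; rewrite /= u0 u1 -surjective_pairing.
Qed.

Lemma delta_comm s t : plink s t = Comm -> delta s * delta t = delta t * delta s.
Proof.
rewrite /plink; case Es: (val s) => [i j]; case Et: (val t) => [k l].
case: ifP => [uijkl _|_]; last by case: ifP.
have p2 : 2 < n.-1.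
  have := max_card (mem [:: i; j; k; l]).
  by rewrite card_ord (card_uniqP uijkl) /=; lia.
pose k2 : I := Ordinal p2.
have u0123 : uniq [:: lo ord0; hi ord0; lo k2; hi k2] by [].
have [u [u0 u1 u2 u3]] := frame u0123 uijkl (erefl _).
rewrite (@deltaE u ord0 s) ?(@deltaE u k2 t).
- by rewrite !conjgM_left sg_far.
- by apply: val_inj; rewrite /= u2 u3 Et.
- by apply: val_inj; rewrite /= u0 u1 Es.
Qed.

Local Notation A := (artin plink).
Local Notation d := (@agen S plink).

Lemma emb_exists : exists emb : A -> G,
  [/\ emb 1 = 1, forall a b, emb (a * b) = emb a * emb b
    & forall s, emb (d s) = delta s].
Proof.
case: (@artin_action S plink G (fun s g => delta s * g) (fun s g => (delta s)^-1 * g)).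
- by move=> s g; rewrite mulKg.
- by move=> s g; rewrite mulVKg.
- by move=> s t _ mst g /=; rewrite !mulgA delta_comm.
- by move=> s t _ mst g /=; rewrite !mulgA delta_braid.
move=> op [op1 opM opE]; exists (fun a => op a 1); split=> [|a b|s].
- exact: op1.
- have opr c g h : op c (g * h) = op c g * h.
    elim/artin_ind: c g => [|s c IH|s c IH] g; first by rewrite !op1.
      by rewrite !opM IH !opE mulgA.
    have opV x : op (d s)^-1 x = (delta s)^-1 * x.
      by apply: (mulgI (delta s)); rewrite -opE -opM mulgV op1 mulVKg.
    by rewrite !opM IH !opV mulgA.
  by rewrite opM -{1}[op b 1]mul1g opr.
- by rewrite opE mulg1.
Qed.

Definition emb : A -> G := sval (cid emb_exists).

Lemma emb1 : emb 1 = 1. Proof. by case: (svalP (cid emb_exists)). Qed.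
Lemma embM a b : emb (a * b) = emb a * emb b.
Proof. by case: (svalP (cid emb_exists)). Qed.
Lemma emb_gen s : emb (d s) = delta s.
Proof. by case: (svalP (cid emb_exists)). Qed.
Lemma embV a : emb a^-1 = (emb a)^-1.
Proof. by apply: (mulgI (emb a)); rewrite -embM !mulgV emb1. Qed.

Lemma emb_conj u (X : pred S) a : gen X a -> exists2 b,
  ev u * emb a * (ev u)^-1 = emb b & gen (fun s => X (pact (wperm (ev u))^-1 s)) b.
Proof.
have XK s : X s -> X (pact (wperm (ev u))^-1 (pact (wperm (ev u)) s)).
  by rewrite -pactM mulgV pact1.
elim=> [|s {}a Xs _ [b Eb Xb]|s {}a Xs _ [b Eb Xb]].
- by exists 1; [rewrite emb1 mulg1 mulgV|exact: gen_one].
- exists (d (pact (wperm (ev u)) s) * b); last exact: gen_mul (XK s Xs) Xb.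
  by rewrite !embM -conjgM_left Eb !emb_gen delta_conj.
- exists ((d (pact (wperm (ev u)) s))^-1 * b); last exact: gen_mulV (XK s Xs) Xb.
  by rewrite !embM -conjgM_left Eb !embV !emb_gen -delta_conj !invgM invgK !mulgA.
Qed.

Lemma emb_tau_decomp (g : G) : exists a u, g = emb a * ev u.
Proof.
elim/vb_ind: g => [|i g [a [u ->]]|i g [a [u ->]]|i g [a [u ->]]|i g [a [u ->]]].
- by exists 1, [::]; rewrite emb1 mulg1.
- by exists (d (base i) * a), u; rewrite embM emb_gen delta_base mulgA.
- by exists ((d (base i))^-1 * a), u; rewrite embM embV emb_gen delta_base mulgA.
- have [b Eb _] := emb_conj [:: i] (gen_predT a).
  by exists b, (i :: u); rewrite -Eb /= mulg1 !mulgA mulgVK.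
- have [b Eb _] := emb_conj [:: i] (gen_predT a).
  by exists b, (i :: u); rewrite -Eb /= mulg1 tuV !mulgA -[_ * tu i * tu i]mulgA
    tu_invol mulg1.
Qed.

(* [G] acts on [A * 'S_n], a crossing of the strands [i, j] multiplying by the
   generator [(i, j)]; the kernel of [theta] then acts on [A] by left
   multiplication. *)
Lemma emb_inj : injective emb.
Proof.
pose phi (c : S -> A) (i : I) (y : A * {perm 'I_n}) := c (pact y.2 (base i)) * y.1.
case: (@vb_action p A (phi d) (phi (fun s => (d s)^-1))).
- by move=> i [a w]; rewrite /phi /= mulKg.
- by move=> i [a w]; rewrite /phi /= mulVKg.
- move=> i j ij [a w]; have m := base_braid ij; rewrite -(plink_pact w) in m.
  by rewrite /phi /= !mulgA agen_braid // plink_neq ?m.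
- move=> i j ij [a w]; have m := base_comm ij; rewrite -(plink_pact w) in m.
  by rewrite /phi /= !mulgA agen_comm // plink_neq ?m.
- move=> i j ij [a w]; rewrite /phi /=; congr (d _ * _, _).
  by rewrite !pactM base_shift.
- move=> i j ij [a w]; rewrite /phi /=; congr (d _ * _, _).
  by rewrite pactM base_far.
move=> op [op1 opM opS opT].
have opev u z w : op (ev u) (z, w) = (z, theta (ev u) * w).
  elim: u z w => [|i u IH] z w /=; first by rewrite op1 theta1 mul1g.
  by rewrite opM IH opT thetaM theta_tu /= mulgA.
have opevV u z w : op (ev u)^-1 (z, w) = (z, (theta (ev u))^-1 * w).
  by rewrite -ev_rev opev ev_rev thetaV.
have opd s z : op (delta s) (z, 1) = (d s * z, 1).
  have [u us] := base0_reach s; rewrite (deltaE us).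
  by rewrite !opM opevV opS opev /phi /= !mulg1 mulgV -us.
suff E a z : op (emb a) (z, 1) = (a * z, 1).
  by move=> a b ab; have := E a 1; rewrite ab E !mulg1 => -[].
elim/artin_ind: a z => [|s a IH|s a IH] z; first by rewrite emb1 op1 mul1g.
  by rewrite embM opM IH emb_gen opd mulgA.
rewrite embM opM IH embV emb_gen -mulgA.
set y := (_^-1 * _); rewrite -(mulVKg (d s) (a * z)) -/y -opd -opM mulVg op1.
by [].
Qed.

End PureSubgroup.

(** * Indecomposability *)

Section SignedSwap.
Variable T : eqType.
Implicit Types i j k l : T.

Definition signed_swap i j (c : bool) (y : T * bool) : T * bool :=
  if y.1 == i then (j, c (+) y.2)
  else if y.1 == j then (i, c (+) y.2) else y.

Lemma signed_swapC i j c y : signed_swap i j c y = signed_swap j i c y.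
Proof.
rewrite /signed_swap; case: y => x b /=.
by have [->|xi] := eqVneq x i; have [->|xj] := eqVneq i j; rewrite ?eqxx.
Qed.

Lemma signed_swapL i j c b : signed_swap i j c (i, b) = (j, c (+) b).
Proof. by rewrite /signed_swap eqxx. Qed.

Lemma signed_swapR i j c b : signed_swap i j c (j, b) = (i, c (+) b).
Proof. by rewrite signed_swapC signed_swapL. Qed.

Lemma signed_swapD i j c x b : x != i -> x != j -> signed_swap i j c (x, b) = (x, b).
Proof. by rewrite /signed_swap /= => /negbTE -> /negbTE ->. Qed.

Lemma signed_swapK i j c : involutive (signed_swap i j c).
Proof.
case=> x b; have [{x}->|xi] := eqVneq x i.
  by rewrite signed_swapL signed_swapR addbA addbb.
have [{x xi}->|xj] := eqVneq x j; last by rewrite !signed_swapD.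
by rewrite signed_swapR signed_swapL addbA addbb.
Qed.

Lemma signed_swap_comm i j k l c c' : uniq [:: i; j; k; l] -> forall y,
  signed_swap i j c (signed_swap k l c' y) = signed_swap k l c' (signed_swap i j c y).
Proof.
rewrite !cons_uniq !inE !negb_or andbT /=.
case/andP=> /and3P[ij ik il] /andP[/andP[jk jl] kl] [x b].
have [{x}->|xi] := eqVneq x i; first by
  rewrite signed_swapL !(@signed_swapD k l) // signed_swapL.
have [{x xi}->|xj] := eqVneq x j.
  by rewrite signed_swapR !(@signed_swapD k l) // signed_swapR.
rewrite (@signed_swapD i j c x) //; have [{x xi xj}->|xk] := eqVneq x k.
  by rewrite signed_swapL signed_swapD // eq_sym.
have [{x xi xj xk}->|xl] := eqVneq x l; last by rewrite !signed_swapD.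
by rewrite signed_swapR signed_swapD // eq_sym.
Qed.

Lemma signed_swap_braid i j k c c' : uniq [:: i; j; k] -> forall y,
  signed_swap i j c (signed_swap j k c' (signed_swap i j c y)) =
  signed_swap j k c' (signed_swap i j c (signed_swap j k c' y)).
Proof.
rewrite !cons_uniq !inE !negb_or andbT /= => /andP[/andP[ij ik] jk] [x b].
have ki : k != i by rewrite eq_sym.
have kj : k != j by rewrite eq_sym.
have [{x}->|xi] := eqVneq x i.
  rewrite !(@signed_swapD j k c' i) // !signed_swapL signed_swapD //.
have [{x xi}->|xj] := eqVneq x j.
  rewrite signed_swapR (@signed_swapD j k) // signed_swapL signed_swapL.
  by rewrite signed_swapD // signed_swapR !addbA !addbb.
rewrite !(@signed_swapD i j c x) //; have [{x xi xj}->|xk] := eqVneq x k.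
  by rewrite signed_swapR signed_swapR signed_swapD.
by rewrite !signed_swapD.
Qed.

End SignedSwap.

Lemma factor_conj (G : groupType) (H K : {pred G}) x g :
  internal_direct_product H K -> x \in H -> g * x * g^-1 \in H.
Proof.
move=> [gH _ HK _ /(_ g)[h [k [Hh Kk ->]]]] Hx.
rewrite invgM !mulgA -[h * k * x]mulgA -(HK x k) // !mulgA mulgK.
by do 2?apply: (group_closedM gH); rewrite ?(group_closedV gH).
Qed.

Section Indecomposability.
Variable p : nat.

Local Notation n := p.+2.
Local Notation G := (virtual_braid_group n).
Local Notation S := {x : 'I_n * 'I_n | x.1 != x.2}.
Local Notation A := (artin (@plink p)).
Local Notation d := (@agen S (@plink p)).

Definition pair_rev (s : S) : S :=
  Sub ((val s).2, (val s).1) (contra_neq esym (valP s)).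

Lemma pair_rev_neq s : pair_rev s != s.
Proof.
apply: contraNneq (valP s) => /(congr1 val) /(congr1 fst) /= E.
by rewrite -[X in X == _]E.
Qed.

Lemma plink_rev s : plink s (pair_rev s) = Free.
Proof.
rewrite /plink /=; case: (val s) => i j /=.
by rewrite !inE !eqxx !orbT !andbF.
Qed.

Lemma pure_action (Z : Type) (f : S -> Z -> Z) :
    (forall s, involutive (f s)) ->
    (forall s t : S, uniq [:: (val s).1; (val s).2; (val t).1; (val t).2] ->
       forall z, f s (f t z) = f t (f s z)) ->
    (forall s t : S, (val s).2 = (val t).1 ->
       uniq [:: (val s).1; (val s).2; (val t).2] ->
       forall z, f s (f t (f s z)) = f t (f s (f t z))) ->
  exists op : A -> Z -> Z,
    [/\ forall z, op 1 z = z, forall g h z, op (g * h) z = op g (op h z)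
      & forall s z, op (d s) z = f s z].
Proof.
move=> fK fC fB.
have B s t : (val s).2 = (val t).1 -> (val s).1 != (val t).2 -> forall z,
    f s (f t (f s z)) = f t (f s (f t z)).
  move=> st1 st2; apply: fB => //; have := valP t; rewrite -st1 => ut.
  by rewrite !cons_uniq !inE negb_or (valP s) st2 ut.
apply: (artin_action (f := f) (f' := f)) => // s t _.
  move=> mst; apply: fC; move: mst; rewrite /plink.
  by case: (val s) => i j; case: (val t) => k l; case: ifP => // _; case: ifP.
by move=> /plink_braidP[[]|[]] st1 st2 z; [exact: B|apply: esym; exact: B].
Qed.

Lemma twisted_centraliser (w : {perm 'I_n}) (a : A) :
  (forall s, a * d (pact w s) * a^-1 = d s) -> w = 1.
Proof.
move=> aw; apply/permP => i; rewrite perm1; apply/eqP/negPn/negP => wi.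
have trivial_conj (Z : Type) (op : A -> Z -> Z) x : (forall z, op 1 z = z) ->
    (forall g h z, op (g * h) z = op g (op h z)) -> (forall z, op x z = z) ->
    forall z, op (a * x * a^-1) z = z.
  by move=> op1 opM opx z; rewrite !opM opx -opM mulgV op1.
have [p0|p0] := posnP p.
  have iwi : (i, w i).1 != (i, w i).2 by rewrite eq_sym.
  pose s : S := Sub (i, w i) iwi.
  case: (@pure_action bool (fun t b => (t == s) (+) b)).
  - by move=> t b; rewrite addbA addbb.
  - by move=> t u _ b; rewrite addbCA.
  - move=> t u _ utu; exfalso.
    have := max_card (mem [:: (val t).1; (val t).2; (val u).2]).
    by rewrite card_ord (card_uniqP utu) /=; lia.
  move=> op [op1 opM opE].
  have ws : pact w s == s = false.
    by apply/negP => /eqP/(congr1 val) [] /eqP; rewrite (negbTE wi).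
  have triv b : op (d (pact w s)) b = b by rewrite opE ws.
  by have := trivial_conj _ op _ op1 opM triv false; rewrite aw opE eqxx.
have [j] : exists j, j \notin [:: i; w i].
  apply/existsP; rewrite -negb_forall; apply/negP => /forallP h.
  have := uniq_leq_size (enum_uniq 'I_n) (fun x _ => h x).
  by rewrite size_enum_ord /=; lia.
rewrite !inE negb_or => /andP[ji jwi].
have ij : (i, j).1 != (i, j).2 by rewrite eq_sym.
pose s : S := Sub (i, j) ij.
case: (@pure_action _ (fun t => signed_swap (val t).1 (val t).2 (t == s))).
- by move=> t; exact: signed_swapK.
- by move=> t u; exact: signed_swap_comm.
- by move=> t u tu; rewrite -tu; exact: signed_swap_braid.
move=> op [op1 opM opE].
have ws : pact w s == s = false.
  by apply/negP => /eqP/(congr1 val) [] /eqP; rewrite (negbTE wi).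
have wrs : pact w (pair_rev s) == s = false.
  by apply/negP => /eqP/(congr1 val) [] _ /eqP; rewrite eq_sym (negbTE jwi).
have triv z : op (d (pact w s) * d (pact w (pair_rev s))) z = z.
  by rewrite opM !opE ws wrs /= [X in signed_swap _ _ _ X]signed_swapC signed_swapK.
have := trivial_conj _ op _ op1 opM triv (i, false).
rewrite -conjgM_left !aw opM !opE (negbTE (pair_rev_neq s)) eqxx /=.
by rewrite signed_swapR signed_swapR.
Qed.

Lemma pure_trivial (P : G -> Prop) :
    (forall g h, P g -> P (h * g * h^-1)) ->
    (forall a, P (emb a) -> edge (base ord0) (pair_rev (base ord0)) a) ->
  forall a : A, P (emb a) -> a = 1.
Proof.
move=> Pconj Pedge a Pa; apply: (gen_all (@plinkC p)) => s.
have [u us] := base0_reach s.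
have [b Eb _] := emb_conj (rev u) (gen_predT a).
have /Pedge : P (emb b) by rewrite -Eb; exact: Pconj.
move=> /(emb_conj u)[c Ec]; have -> : c = a.
  by apply: emb_inj; rewrite -Ec -Eb ev_rev invgK !mulgA mulgV mul1g mulgK.
apply: gen_sub => t /andP[+ _]; apply: contra_neq => ->.
by rewrite -us -pactM mulgV pact1.
Qed.

Lemma factor_trivial (H K : {pred G}) : internal_direct_product H K ->
  (forall a, emb a \in H -> a = 1) -> forall h, h \in H -> h = 1.
Proof.
move=> dec H1 h Hh; have [gH _ _ _ _] := dec.
have [a [u hE]] := emb_tau_decomp h.
have u1 : wperm (ev u) = 1.
  apply: (@twisted_centraliser _ a) => s.
  apply: (mulIg (d s)^-1); rewrite mulgV; apply: H1.
  rewrite !embM !embV emb_gen -delta_conj -emb_gen !mulgA -hE.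
  have -> : h * emb (d s) * (ev u)^-1 * (emb a)^-1 * (emb (d s))^-1 =
      h * (emb (d s) * h^-1 * (emb (d s))^-1) by rewrite hE invgM !mulgA.
  apply: (group_closedM gH) => //; apply: (factor_conj _ dec).
  exact: (group_closedV gH).
move: hE; rewrite tau_word_faithful // mulg1 => hE.
by rewrite hE (H1 a) ?emb1 // -hE.
Qed.

Lemma vb_indecomposable : indecomposable G.
Proof.
move=> [H [K [HK [x xH] [y yK]]]]; have [gH gK comHK HK1 HKG] := HK.
have KH : internal_direct_product K H.
  split=> // [k h Kk Hh|z Kz Hz|g]; [by rewrite -(comHK h k)|exact: HK1|].
  by have [h [k [Hh Kk ->]]] := HKG g; exists k, h; split=> //; exact: comHK.
have trivial_factor (H' K' : {pred G}) z : internal_direct_product H' K' ->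
    z \notin K' ->
    ~ (forall a, emb a \in H' -> edge (base ord0) (pair_rev (base ord0)) a).
  move=> HK' zK' Hedge.
  have H1 := pure_trivial (P := fun g => g \in H') (fun g h => factor_conj h HK') Hedge.
  have [_ _ _ _ /(_ z)[h [k [Hh Kk zE]]]] := HK'.
  by move: zK'; rewrite zE (factor_trivial HK' H1 Hh) mul1g Kk.
have emb_conj_closed (H' K' : {pred G}) : internal_direct_product H' K' ->
    (forall a : A, emb a \in H' -> emb a^-1 \in H') /\
    (forall a b : A, emb a \in H' -> emb (b * a * b^-1) \in H').
  move=> HK'; split=> [a|a b]; rewrite ?embM embV; last exact: factor_conj HK'.
  by case: HK' => gH' *; exact: group_closedV.
have [HV HC] := emb_conj_closed H K HK; have [KV KC] := emb_conj_closed K H KH.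
have s0t0 : base ord0 != pair_rev (base ord0) by rewrite eq_sym pair_rev_neq.
case: (commuting_in_edge (@plinkC p) s0t0 (plink_rev _) HV HC KV KC).
- by move=> a b Ha Kb; apply: emb_inj; rewrite !embM comHK.
- exact: trivial_factor HK yK.
- exact: trivial_factor KH xH.
Qed.

End Indecomposability.

Theorem mainTheorem5 (n : nat) : indecomposable (virtual_braid_group n).
Proof.
have small k : (k.-1 = 0)%N -> indecomposable (virtual_braid_group k).
  move=> k0 [H [K [[[H1 _] _ _ _ _] [x xH] _]]].
  suff x1 : x = 1 by rewrite x1 H1 in xH.
  by elim/pres_ind: x {xH} => // -[] i; exfalso; have := ltn_ord i; lia.
by case: n => [|[|p]]; [exact: small|exact: small|exact: vb_indecomposable].
Qed.
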